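(* Let $M=\{1^{k_1},2^{k_2},\ldots,n^{k_n}\}$ be a multiset with $n\ge1$ and $k_1,\ldots,k_n$ positive integers. Let $K=k_1+\cdots+k_n$ and let $s$ be a positive integer. Then $$p_s(t;\overline{Q}_M)=p_s(t;n,K-n+1).$$ Furthermore, $p_s(t;n,k)$ satisfies the recurrence $$p_s(t;n,k)=\sum_{m=1}^n\tilde{W}_{s,m}(t)\left(\binom{n-1}{m}p_s(t;n-m,k)+\binom{n-1}{m-1}p_s(t;n-m+1,k-1)\right)$$ for $n\ge s$ and $k\ge1$, and $p_s(t;n,0)=p_s(t;n-1,1)$ for $n\ge2$. The initial conditions are $p_s(t;n,k)=(n+k-1)!/k!$ for $1\le n\le s-1$ and $k\ge0$, and $p_s(t;n,k)=0$ whenever $n\le0$ or $k<0$. The exponential generating function $\mathcal{P}_s(t,x,y)=\sum_{n\ge1,\,k\ge0}\frac{p_s(t;n,k)}{(n-1)!}x^ny^k$ is given by $$\mathcal{P}_s(t,x,y)=\frac{x}{1-\tilde{\mathcal{W}}_s(t,x)-y\cdot\tilde{\mathcal{W}}_s'(t,x)},$$ where the prime denotes differentiation with respect to $x$.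
   Context: $\{1^{k_1},\ldots,n^{k_n}\}$ denotes the multiset containing $k_\ell$ copies of the letter $\ell$ for each $\ell\in\{1,\ldots,n\}$; exponents equal to $1$ are omitted. A permutation (multipermutation) of $M$ is a word $\pi=\pi_1\cdots\pi_{|M|}$ in which each letter $\ell$ occurs exactly $k_\ell$ times; $S_M$ is the set of all of them. It is quasi-Stirling if there are no indices $j_1<j_2<j_3<j_4$ with $\pi_{j_1}=\pi_{j_3}$, $\pi_{j_2}=\pi_{j_4}$ and $\pi_{j_1}\ne\pi_{j_2}$. $\overline{Q}_M$ is the set of quasi-Stirling permutations of $M$. For $s\ge1$, $(\underline{s\cdots21})\pi$ is the number of indices $j$ such that $1\le j\le|M|-s+1$ and $\pi_j>\pi_{j+1}>\cdots>\pi_{j+s-1}$ (so $(\underline{1})\pi=|M|$). Define $p_s(t;\overline{Q}_M)=\sum_{\pi\in\overline{Q}_M}t^{(\underline{s\cdots21})\pi}$, and for $n\ge1$, $k\ge0$, with $M'=\{1^k,2,\ldots,n\}$, $p_s(t;n,k)=\sum_{\pi\in S_{M'}}t^{(\underline{s\cdots21})\pi}$ (for $n=1,k=0$ the only permutation is the empty word); $p_s(t;n,k)$ is set to $0$ if $n\le0$ or $k<0$. The functions $\tilde{W}_{s,n}(t)$ are defined by $$1-\sum_{n=1}^\infty\tilde{W}_{s,n}(t)z^n=\left(\sum_{n=0}^{s-1}z^n+\sum_{n=s}^\infty t^{n-s+1}z^n\right)^{-1},\quad\text{equivalently}\quad\sum_{n=1}^\infty\tilde{W}_{s,n}(t)z^n=\frac{(t-1)z^s-tz^2+z}{1-tz+(t-1)z^s},$$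 and $\tilde{\mathcal{W}}_s(t,x)=\sum_{n=1}^\infty\tilde{W}_{s,n}(t)\frac{x^n}{n!}$. All generating functions are formal power series. *)

(* Defs.v *)
From HB Require Import structures.
From mathcomp Require Import all_boot all_order all_algebra.
From mathcomp Require Import boolp.

Set Implicit Arguments.
Unset Strict Implicit.
Unset Printing Implicit Defensive.

Import Order.TTheory GRing.Theory Num.Theory.
Local Open Scope ring_scope.

(* Formal power series in one variable. Series in two variables are obtained
   by iterating the construction.                                           *)

Record fps (R : Type) := Fps { coef_fps :> nat -> R }.
Add Printing Constructor fps.

Notation "{ 'fps' R }" := (fps R) (at level 0, R at level 2,
  format "{ 'fps'  R }") : type_scope.
Notation "\fps_ i E" := (Fps (fun i : nat => E))
  (at level 36, E at level 36, i at level 0,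
   format "\fps_ i  E") : ring_scope.

Lemma fpsP (R : Type) (f g : {fps R}) : f =1 g <-> f = g.
Proof.
split=> [|-> //]; case: f g => [f] [g] /= fg.
by congr Fps; apply/funext.
Qed.

HB.instance Definition _ (R : Type) := gen_eqMixin {fps R}.
HB.instance Definition _ (R : Type) := gen_choiceMixin {fps R}.

Section FpsZmodule.
Variable V : zmodType.
Implicit Types f g h : {fps V}.

Definition fps_zero : {fps V} := \fps_i 0.
Definition fps_opp f : {fps V} := \fps_i (- f i).
Definition fps_add f g : {fps V} := \fps_i (f i + g i).

Fact fps_addA : associative fps_add.
Proof. by move=> f g h; apply/fpsP => i /=; rewrite addrA. Qed.
Fact fps_addC : commutative fps_add.
Proof. by move=> f g; apply/fpsP => i /=; rewrite addrC. Qed.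
Fact fps_add0 : left_id fps_zero fps_add.
Proof. by move=> f; apply/fpsP => i /=; rewrite add0r. Qed.
Fact fps_addN : left_inverse fps_zero fps_opp fps_add.
Proof. by move=> f; apply/fpsP => i /=; rewrite addNr. Qed.

HB.instance Definition _ :=
  GRing.isZmodule.Build {fps V} fps_addA fps_addC fps_add0 fps_addN.
End FpsZmodule.

Section FpsRing.
Variable R : comNzRingType.
Implicit Types f g h : {fps R}.

Definition fpsC (c : R) : {fps R} := \fps_i (if i == 0%N then c else 0).
Definition fpsX : {fps R} := \fps_i (i == 1%N)%:R.
Definition fps_mul f g : {fps R} :=
  \fps_i (\sum_(j < i.+1) f j * g (i - j)%N).
Definition fps_deriv f : {fps R} := \fps_i (f i.+1 *+ i.+1).

Definition fps_trunc n f : {poly R} := \poly_(i < n) f i.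

Fact coef_fps_mul_trunc f g i n m : (i < n)%N -> (i < m)%N ->
  (fps_trunc n f * fps_trunc m g)`_i = fps_mul f g i.
Proof.
move=> ltin ltim; rewrite coefM; apply: eq_bigr => j _.
rewrite !coef_poly (leq_ltn_trans (leq_ord j) ltin).
by rewrite (leq_ltn_trans (leq_subr _ _) ltim).
Qed.

Fact fps_mulC : commutative fps_mul.
Proof.
move=> f g; apply/fpsP => i.
by rewrite -!(@coef_fps_mul_trunc _ _ i i.+1 i.+1) // mulrC.
Qed.

Fact fps_mulA : associative fps_mul.
Proof.
move=> f g h; apply/fpsP => i.
transitivity ((fps_trunc i.+1 f * (fps_trunc i.+1 g * fps_trunc i.+1 h))`_i).
  rewrite coefM; apply: eq_bigr => j _; rewrite coef_poly ltn_ord.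
  by rewrite coef_fps_mul_trunc // ltnS leq_subr.
rewrite mulrA coefM; apply: eq_bigr => j _.
by rewrite coef_fps_mul_trunc ?ltn_ord // coef_poly ltnS leq_subr.
Qed.

Fact fps_mul1 : left_id (fpsC 1) fps_mul.
Proof.
move=> f; apply/fpsP => i /=; rewrite big_ord_recl /= mul1r subn0.
by rewrite big1 ?addr0 // => j _; rewrite mul0r.
Qed.

Fact fps_mulDl : left_distributive fps_mul +%R.
Proof.
move=> f g h; apply/fpsP => i /=; rewrite -big_split /=.
by apply: eq_bigr => j _; rewrite mulrDl.
Qed.

Fact fps_1_neq0 : fpsC 1 != 0.
Proof. by apply/eqP => /fpsP /(_ 0%N) /eqP; rewrite /= oner_eq0. Qed.

HB.instance Definition _ := GRing.Zmodule_isComNzRing.Build {fps R}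
  fps_mulA fps_mulC fps_mul1 fps_mulDl fps_1_neq0.
End FpsRing.

Notation "c %:S" := (fpsC c) (at level 2, left associativity,
  format "c %:S") : ring_scope.

Section FpsUnitRing.
Variable R : comUnitRingType.
Implicit Types f g : {fps R}.

Definition fps_unit : {pred {fps R}} := fun f => f 0%N \is a GRing.unit.

(* The coefficients g_0, ..., g_n of the inverse of f, from g_0 = f_0^-1 and
   f_0 g_(n+1) = - \sum_(i <= n) f_(i+1) g_(n-i).                           *)
Fixpoint fps_inv_seq f n : seq R :=
  if n is n'.+1 then
    let g := fps_inv_seq f n' in
    rcons g (- (f 0%N)^-1 * \sum_(i < n) f i.+1 * g`_(n' - i))
  else [:: (f 0%N)^-1].

Definition fps_inv f : {fps R} :=
  if f \in fps_unit then \fps_n (fps_inv_seq f n)`_n else f.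

Fact size_fps_inv_seq f n : size (fps_inv_seq f n) = n.+1.
Proof. by elim: n => //= n IHn; rewrite size_rcons IHn. Qed.

Fact nth_fps_inv_seq f n i : (i <= n)%N ->
  (fps_inv_seq f n)`_i = (fps_inv_seq f i)`_i.
Proof.
elim: n => [|n IHn]; first by rewrite leqn0 => /eqP ->.
rewrite leq_eqVlt => /predU1P [-> //|]; rewrite ltnS => lein.
by rewrite /= nth_rcons size_fps_inv_seq ltnS lein IHn.
Qed.

Fact fps_mulVf : {in fps_unit, left_inverse 1 fps_inv *%R}.
Proof.
move=> f Uf; rewrite mulrC /fps_inv Uf; apply/fpsP => -[|n].
  by rewrite /= big_ord1 /= mulrV.
rewrite /= big_ord_recl /= nth_rcons size_fps_inv_seq ltnn eqxx.
rewrite mulrA mulrN mulrV // mulN1r; apply/eqP; rewrite addrC subr_eq0.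
apply/eqP/eq_bigr => i _; rewrite /bump /= add1n subSS.
by rewrite [RHS](_ : _ = f i.+1 * (fps_inv_seq f n)`_(n - i)) // nth_fps_inv_seq
  ?leq_subr.
Qed.

Fact fps_unitPl f g : g * f = 1 -> fps_unit f.
Proof.
move/fpsP/(_ 0%N); rewrite /= big_ord1 /= => gf1.
by apply/unitrPr; exists (g 0%N); rewrite mulrC.
Qed.

Fact fps_inv_out : {in [predC fps_unit], fps_inv =1 id}.
Proof. by move=> f /negbTE Uf; rewrite /fps_inv [f \in _]Uf. Qed.

HB.instance Definition _ := GRing.ComNzRing_hasMulInverse.Build {fps R}
  fps_mulVf fps_unitPl fps_inv_out.
End FpsUnitRing.

(* {1^(k 1), 2^(k 2), ..., n^(k n)} as its nondecreasing word; only the values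
   k 1, ..., k n are used.                                                  *)
Definition multiset_word (n : nat) (k : nat -> nat) : seq nat :=
  flatten [seq nseq (k l) l | l <- iota 1 n].

Definition quasi_stirling (w : seq nat) : bool :=
  let w_ := nth 0%N w in
  ~~ [exists j1 : 'I_(size w), exists j2 : 'I_(size w),
      exists j3 : 'I_(size w), exists j4 : 'I_(size w),
      [&& (j1 < j2)%N, (j2 < j3)%N, (j3 < j4)%N,
          w_ j1 == w_ j3, w_ j2 == w_ j4 & w_ j1 != w_ j2]].

(* Positions are counted from 0, and there are none when size w < s.        *)
Definition consec_decr (s : nat) (w : seq nat) : nat :=
  count (fun j => [forall i : 'I_s.-1,
                     (nth 0 w (j + i).+1 < nth 0 w (j + i))%N])
        (iota 0 ((size w).+1 - s)).

(* The variable t is the indeterminate 'X of {poly rat}.                    *)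

Definition p_quasi (s n : nat) (k : nat -> nat) : {poly rat} :=
  \sum_(w <- permutations (multiset_word n k) | quasi_stirling w)
    'X^(consec_decr s w).

Definition p_ (s : nat) (n k : int) : {poly rat} :=
  if (n <= 0) || (k < 0) then 0 else
  \sum_(w <- permutations
         (multiset_word `|n|%N (fun l => if l == 1%N then `|k|%N else 1%N)))
    'X^(consec_decr s w).

Definition run_series (s : nat) : {fps {poly rat}} :=
  \fps_n (if (n < s)%N then 1 else 'X^(n - s + 1)).

(* 1 - \sum_(n >= 1) Wt s n z^n = (run_series s)^-1                         *)
Definition Wt (s n : nat) : {poly rat} := (1 - (run_series s)^-1) n.

Definition Wt_egf (s : nat) : {fps {poly rat}} :=
  \fps_n (if n == 0%N then 0 else (n`!%:R^-1 : rat) *: Wt s n).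

(* Series in x and y are series in y whose coefficients are series in x.    *)
Definition xvar : {fps {fps {poly rat}}} := (fpsX _)%:S.
Definition yvar : {fps {fps {poly rat}}} := fpsX _.

Definition P_egf (s : nat) : {fps {fps {poly rat}}} :=
  \fps_k \fps_n (if n == 0%N then 0
                 else ((n.-1)`!%:R^-1 : rat) *: p_ s n%:Z k%:Z).

(* Main.v *)
Require Import Defs.
From mathcomp Require Import all_boot all_order all_algebra.
From mathcomp Require Import zify ring.

(** Why the theorem holds.

    All sums over words are instances of one family.  For a sequence [phi] with
    [phi 0 = 1] in a commutative ring, weigh a word by the product of
    [phi (length)] over its maximal strictly decreasing runs.  A run of length r
    contains (r + 1 - s)^+ decreasing factors of length s, so the coefficients
    of [run_series s] turn the run weight into t to the power of the statistic
    ([run_weight_consec]).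

    Equality of the quasi-Stirling sum with the sum over {1^(K-n+1), 2, ..., n}.
    The sum of run weights over the quasi-Stirling words of {1^k1, ..., n^kn}
    depends only on n and K, for every ring and every [phi]
    ([quasi_sum_uniform]).  This goes by induction on n, with two moves.

    - Merging ([quasi_sum_merge]): only k1 + k2 matters.  Close the word into a
      circle with a separator 0.  Call an occurrence of 1 or 2 a star.  In a
      noncrossing circular word the 1s and the 2s occupy two arcs, and the word
      consists of stars separated by gaps.  Every other letter exceeds both
      stars, so a star always ends its run and the gaps have independent
      weights; the only interaction is a descent 2 1, which occurs when the gap
      between the last 2 and the first 1 is empty.  A gap between equal stars
      shares no letter with the rest, while the two gaps where the star changes
      may share letters.  Hence, to turn the first 2 into a 1, exchange the gaps
      on its two sides, so that the shared gap again lies where the star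
      changes; if the gap after the last 2 is empty nothing is shared and no
      exchange is made.  This is the bijection [transfer].  Cutting the circle
      at the unique passage from a 2 to a 1 makes it linear ([rooted]), and the
      separator, carried by its gap, remembers where the word started.

    - Peeling ([quasi_sum_peel]): if k1 = 1, the letter 1 may be inserted
      anywhere in a quasi-Stirling word of the larger letters.  At the start it
      is a new run; elsewhere it prolongs a run or cuts it in two.  Summed over
      the latter positions, this is a derivation applied to a product of run
      weights, that is, the first-order coefficient of a run weight over the
      dual numbers ([peeled], realized in {poly R}).  The number of letters
      drops but the weights change, which is why the induction ranges over all
      rings and all [phi].

    Merging (k1, k2) to (1, k1 + k2 - 1), peeling, using induction, and undoing
    both moves brings the multiplicities to (K - n + 1, 1, ..., 1).  With a
    single repeated letter every word is quasi-Stirling.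

    Recurrence.  If W is related to [phi] by
    phi_r = sum_(1 <= m <= r) W_m phi_(r-m), then the weight of a nonempty word
    w is the sum of W_m times the weight of w without its first m letters, over
    those m for which these letters decrease: only the first run matters, and
    there it is the relation itself ([run_weight_rec]).  Summing over all
    permutations of {1^k, 2, ..., n}, a decreasing prefix of length m is a set
    of m letters; C(n-1, m) of these sets avoid 1 and C(n-1, m-1) contain it
    ([perm_sum_rec]).  For [phi] given by [run_series s] the sequence W is
    [Wt s].  The recurrence is valid for all (n, k) with n + k > 1, so it also
    gives the initial values, where W is 1, 0, 0, ..., and, coefficient by
    coefficient, the exponential generating function ([P_egfE]). *)

Set Implicit Arguments.
Unset Strict Implicit.
Unset Printing Implicit Defensive.

Import Order.TTheory GRing.Theory Num.Theory.
Local Open Scope ring_scope.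

(** * Sums along a one-to-one relation *)

(** A bijection given as a relation: existence and uniqueness in both directions
    are often easier to establish than a pair of mutually inverse functions. *)
Lemma eq_sum_rel (V : nmodType) (I J : eqType) (r1 : seq I) (r2 : seq J)
    (F1 : I -> V) (F2 : J -> V) (rel : I -> J -> Prop) :
  uniq r1 -> uniq r2 ->
  (forall i, i \in r1 -> exists2 j, j \in r2 & rel i j) ->
  (forall j, j \in r2 -> exists2 i, i \in r1 & rel i j) ->
  (forall i j j', i \in r1 -> j \in r2 -> j' \in r2 ->
     rel i j -> rel i j' -> j = j') ->
  (forall i i' j, i \in r1 -> i' \in r1 -> j \in r2 ->
     rel i j -> rel i' j -> i = i') ->
  (forall i j, i \in r1 -> j \in r2 -> rel i j -> F1 i = F2 j) ->
  \sum_(i <- r1) F1 i = \sum_(j <- r2) F2 j.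
Proof.
elim: r1 r2 => [|i r1 IHr] r2 Ur1 Ur2 tot1 tot2 fun1 fun2 eqF.
  case: r2 {Ur2} tot2 {tot1 fun1 fun2 eqF} => [|j r2] tot2; rewrite ?big_nil //.
  by case: (tot2 j (mem_head _ _)).
have [j jr2 rij] := tot1 i (mem_head _ _).
have{Ur1} /= /andP [ir1 Ur1] := Ur1.
rewrite big_cons (perm_big _ (perm_to_rem jr2)) big_cons /=.
rewrite (eqF _ _ (mem_head _ _) jr2 rij); congr (_ + _).
have memr k : k \in r1 -> k \in i :: r1 by rewrite inE => ->; rewrite orbT.
apply: IHr => //.
- exact: rem_uniq.
- move=> k kr1; have [l lr2 rkl] := tot1 k (memr _ kr1); exists l => //.
  rewrite mem_rem_uniq // inE lr2 andbT; apply: contraNneq ir1 => eq_lj.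
  by rewrite -(fun2 k i j (memr _ kr1) (mem_head _ _) jr2) // -eq_lj.
- move=> l; rewrite mem_rem_uniq // inE => /andP [neq_lj lr2].
  have [k] := tot2 l lr2; rewrite inE => /predU1P [-> ril|kr1 rkl]; last by exists k.
  by rewrite (fun1 i l j (mem_head _ _) lr2 jr2 ril rij) eqxx in neq_lj.
- move=> k l l' /memr kr1 /mem_rem lr2 /mem_rem lr2'; exact: fun1.
- move=> k k' l /memr kr1 /memr kr1' /mem_rem lr2; exact: fun2.
- move=> k l /memr kr1 /mem_rem; exact: eqF.
Qed.

(** * Splitting sequences *)
Lemma split_first (T : eqType) (x : T) s :
  x \in s -> exists A B, s = A ++ x :: B /\ x \notin A.
Proof.
elim: s => // y s IHs; rewrite inE.
have [<- _|neq_xy /= /IHs [A [B [-> xA]]]] := eqVneq x y.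
  by exists [::], s.
by exists (y :: A), B; rewrite inE negb_or neq_xy.
Qed.

Lemma split_last (T : eqType) (x : T) s :
  exists A B, [/\ s = A ++ B, last x A = x & x \notin B].
Proof.
elim/last_ind: s => [|s y [A [B [-> lastA xB]]]]; first by exists [::], [::].
have [->|neq_xy] := eqVneq x y.
  by exists (rcons (A ++ B) y), [::]; rewrite cats0 last_rcons.
by exists A, (rcons B y); rewrite rcons_cat mem_rcons inE negb_or neq_xy.
Qed.

Lemma cat_cons_inj (T : eqType) (x : T) A B A' B' :
  x \notin A -> x \notin A' -> A ++ x :: B = A' ++ x :: B' -> A = A' /\ B = B'.
Proof.
elim: A A' => [|y A IHA] [|z A'] //= xA xA' [].
- by move=> <-.
- by move=> eq_xz; rewrite eq_xz mem_head in xA'.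
- by move=> eq_yx; rewrite eq_yx mem_head in xA.
move: xA xA'; rewrite !inE !negb_or => /andP [_ xA] /andP [_ xA'].
by move=> -> /(IHA _ xA xA') [-> ->].
Qed.

Lemma last_cat_inj (T : eqType) (x : T) A B A' B' :
  last x A = x -> last x A' = x -> x \notin B -> x \notin B' ->
  A ++ B = A' ++ B' -> A = A' /\ B = B'.
Proof.
elim/last_ind: B B' => [|B y IHB] B'.
  case/lastP: B' => [|B' z]; rewrite ?cats0 // => lastA lastA' _ zB' eqA.
  by rewrite -lastA eqA last_cat last_rcons mem_rcons mem_head in zB'.
case/lastP: B' => [|B' z].
  rewrite cats0 => lastA lastA' yB _ eqA.
  by rewrite -lastA' -eqA last_cat last_rcons mem_rcons mem_head in yB.
move=> lastA lastA'; rewrite !mem_rcons !inE !negb_or.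
move=> /andP [_ xB] /andP [_ xB']; rewrite -!rcons_cat => /rcons_inj [eqAB ->].
by have [-> ->] := IHB _ lastA lastA' xB xB' eqAB.
Qed.

Lemma cat_cons_case (T : eqType) (x y : T) A B C D :
  x != y -> A ++ x :: B = C ++ y :: D ->
  (exists E, A = C ++ y :: E /\ D = E ++ x :: B) \/
  (exists E, C = A ++ x :: E /\ B = E ++ y :: D).
Proof.
move=> neq_xy; elim: A C => [|z A IHA] [|t C] /=.
- by move=> [] eq_xy; rewrite eq_xy eqxx in neq_xy.
- by case=> <- ->; right; exists C.
- by case=> -> <-; left; exists A.
- by case=> -> /IHA [] [E [-> ->]]; [left|right]; exists E.
Qed.

(** * Noncrossing words *)
Lemma subseq_cat_split (T : eqType) (s A B : seq T) :
  subseq s (A ++ B) ->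
  exists s1 s2, [/\ s = s1 ++ s2, subseq s1 A & subseq s2 B].
Proof.
elim: A s => [|x A IHA] s /=; first by move=> sB; exists [::], s.
case: s => [|y s]; first by exists [::], [::]; rewrite sub0seq.
case: eqP => [-> /IHA [s1 [s2 [-> s1A s2B]]]|_ /IHA [s1 [s2 [-> s1A s2B]]]].
  by exists (x :: s1), s2; rewrite /= eqxx.
exists s1, s2; split=> //; exact: subseq_trans s1A (subseq_cons _ _).
Qed.

Lemma subseq_cons_catr (T : eqType) (x : T) s A B :
  x \notin A -> subseq (x :: s) (A ++ B) -> subseq (x :: s) B.
Proof.
move=> xA /subseq_cat_split [[|y s1] [s2 [/= Es s1A s2B]]].
  by rewrite Es.
case: Es s1A => <- _ /mem_subseq /(_ x (mem_head _ _)) xA'.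
by rewrite xA' in xA.
Qed.

Lemma subseq_rcons_catl (T : eqType) (x : T) s A B :
  x \notin B -> subseq (rcons s x) (A ++ B) -> subseq (rcons s x) A.
Proof.
rewrite -subseq_rev rev_cat rev_rcons => xB.
move/subseq_cons_catr; rewrite mem_rev => /(_ xB).
by rewrite -rev_rcons subseq_rev.
Qed.

Lemma subseq_cons_split (T : eqType) (x : T) s w :
  subseq (x :: s) w -> exists A B, w = A ++ x :: B /\ subseq s B.
Proof.
elim: w => //= y w IHw; case: eqP => [<- sw|_ /IHw [A [B [-> sB]]]].
  by exists [::], w.
by exists (y :: A), B.
Qed.

Lemma subseq_nth_drop (T : eqType) (x0 : T) s w i j :
  (i <= j < size w)%N -> subseq s (drop j.+1 w) ->
  subseq (nth x0 w j :: s) (drop i w).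
Proof.
move=> /andP [leij ltjw] sw; rewrite -(cat_take_drop (j - i) (drop i w)).
rewrite drop_drop subnK // (drop_nth x0 ltjw).
apply: subseq_trans (suffix_subseq _ _) => /=.
by rewrite eqxx.
Qed.

Lemma quasi_stirlingP (w : seq nat) :
  reflect (forall x y, x != y -> ~~ subseq [:: x; y; x; y] w)
          (quasi_stirling w).
Proof.
apply: (iffP idP) => [qs x y neq_xy|nc].
  apply: contra qs => /subseq_cons_split [A [w1 [-> /subseq_cons_split]]].
  move=> [B [w2 [-> /subseq_cons_split]]].
  move=> [C [w3 [-> /subseq_cons_split [D [E [-> _]]]]]].
  set u := _ ++ _.
  have size_u : size u = (size A + size B + size C + size D + size E + 4)%N.
    by rewrite /u !size_cat /= size_cat /= size_cat /= size_cat /=; lia.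
  have lt1 : (size A < size u)%N by lia.
  have lt2 : (size A + size B + 1 < size u)%N by lia.
  have lt3 : (size A + size B + size C + 2 < size u)%N by lia.
  have lt4 : (size A + size B + size C + size D + 3 < size u)%N by lia.
  apply/existsP; exists (Ordinal lt1); apply/existsP; exists (Ordinal lt2).
  apply/existsP; exists (Ordinal lt3); apply/existsP; exists (Ordinal lt4) => /=.
  have nthE k F z G : size F = k -> nth 0%N (F ++ z :: G) k = z.
    by move=> <-; rewrite nth_cat ltnn subnn.
  have -> : nth 0%N u (size A) = x by rewrite /u nthE.
  have -> : nth 0%N u (size A + size B + 1) = y.
    by rewrite /u -cat_cons catA nthE // size_cat /=; lia.
  have -> : nth 0%N u (size A + size B + size C + 2) = x.
    by rewrite /u -cat_cons catA -cat_cons catA nthE // !size_cat /=; lia.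
  have -> : nth 0%N u (size A + size B + size C + size D + 3) = y.
    rewrite /u -cat_cons catA -cat_cons catA -cat_cons catA nthE //.
    by rewrite !size_cat /=; lia.
  by rewrite !eqxx neq_xy !andbT; lia.
apply/existsP => -[j1 /existsP [j2 /existsP [j3 /existsP [j4]]]].
case/and5P=> lt12 lt23 lt34 /eqP eq13 /andP [/eqP eq24 neq12].
have /negP [] := nc _ _ neq12; rewrite {2}eq13 {2}eq24 -[w in subseq _ w]drop0.
apply: subseq_nth_drop; first by rewrite ltn_ord.
apply: subseq_nth_drop; first by rewrite lt12 ltn_ord.
apply: subseq_nth_drop; first by rewrite lt23 ltn_ord.
by apply: subseq_nth_drop; rewrite ?sub0seq // lt34 ltn_ord.
Qed.

(** Crossing is a cyclic condition: the rotations of x y x y alternate too. *)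
Lemma quasi_stirling_catC A B : quasi_stirling (A ++ B) = quasi_stirling (B ++ A).
Proof.
suff imp C D : quasi_stirling (C ++ D) -> quasi_stirling (D ++ C).
  by apply/idP/idP; apply: imp.
move/quasi_stirlingP=> nc; apply/quasi_stirlingP => x y neq_xy.
apply/negP => /subseq_cat_split [s1 [s2 [Es s1D s2C]]].
have /negP ncxy := nc _ _ neq_xy; rewrite eq_sym in neq_xy.
have /negP ncyx := nc _ _ neq_xy.
have := cat_subseq s2C s1D.
case: s1 Es {s1D} => [|z1 [|z2 [|z3 [|z4 [|z5 s1]]]]] //= [].
- by move=> <-.
- by move=> <- <-.
- by move=> <- <- <-.
- by move=> <- <- <- <-.
- by move=> <- <- <- <- <-.
Qed.

Lemma quasi_stirling_subseq v w :
  subseq v w -> quasi_stirling w -> quasi_stirling v.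
Proof.
move=> vw /quasi_stirlingP nc; apply/quasi_stirlingP => x y /nc.
by apply: contra => /subseq_trans; apply.
Qed.

(** A crossing cannot involve a letter of the factor [C] and a letter outside
    it, because all occurrences of the former are consecutive relative to the
    latter. *)
Lemma quasi_stirling_insert A C B :
  (forall x, x \in C -> x \notin A ++ B) ->
  quasi_stirling (A ++ C ++ B) = quasi_stirling C && quasi_stirling (A ++ B).
Proof.
move=> disjC; apply/idP/andP => [qs|[/quasi_stirlingP qsC /quasi_stirlingP qsAB]].
  split; apply: quasi_stirling_subseq qs.
    exact: subseq_trans (prefix_subseq C B) (suffix_subseq A _).
  by rewrite subseq_cat2l suffix_subseq.
have noA x : x \in C -> x \notin A.
  by move/disjC; rewrite mem_cat negb_or => /andP [].
have noB x : x \in C -> x \notin B.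
  by move/disjC; rewrite mem_cat negb_or => /andP [].
have mixed x y : x \in C -> subseq [:: x; y; x] (A ++ C ++ B) -> y \in C.
  move=> xC /(subseq_cons_catr (noA _ xC)).
  move/(@subseq_rcons_catl _ x [:: x; y] _ _ (noB _ xC)).
  by move/mem_subseq; apply; rewrite !inE eqxx orbT.
apply/quasi_stirlingP => x y neq_xy; apply/negP => sxy.
have [xC|xNC] := boolP (x \in C).
  have yC : y \in C.
    by apply: (mixed x) => //; apply: subseq_trans sxy; exact: (prefix_subseq _ [:: y]).
  have /negP [] := qsC _ _ neq_xy.
  move/(subseq_cons_catr (noA _ xC)): sxy.
  by move/(@subseq_rcons_catl _ y [:: x; y; x] _ _ (noB _ yC)).
have [yC|yNC] := boolP (y \in C).
  case/negP: xNC; apply: (mixed y) => //.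
  by apply: subseq_trans sxy; exact: subseq_cons.
have /negP [] := qsAB _ _ neq_xy.
pose a := [predC C].
have : subseq [:: x; y; x; y] (filter a (A ++ C ++ B)).
  by rewrite subseq_filter sxy /= xNC yNC.
rewrite !filter_cat; suff -> : filter a C = [::].
  by move/subseq_trans; apply; rewrite -filter_cat filter_subseq.
apply/eqP; rewrite -(negbK (_ == _)) -has_filter -all_predC.
by apply/allP => z zC /=; rewrite negbK.
Qed.

Lemma quasi_stirling_dup A x B :
  quasi_stirling (A ++ x :: x :: B) = quasi_stirling (A ++ x :: B).
Proof.
apply/idP/idP; first by apply: quasi_stirling_subseq; rewrite subseq_cat2l subseq_cons.
move/quasi_stirlingP => nc; apply/quasi_stirlingP => y z neq_yz.
apply/negP => /subseq_cat_split [s1 [s2 [Es s1A]]].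
case: s2 Es => [|t s2] Es s2B.
  have /negP [] := nc _ _ neq_yz; rewrite Es cats0.
  exact: subseq_trans s1A (prefix_subseq _ _).
have adj : head (t.+1) s2 != t.
  move: Es neq_yz; case: s1 {s1A} => [|a [|b [|c [|d [|e s1]]]]] //=.
  - by case=> -> <-; rewrite eq_sym.
  - by case=> _ -> <-.
  - by case=> _ _ -> <-; rewrite eq_sym.
  - by case=> _ _ _ -> <- _ /=; rewrite gtn_eqF.
have : subseq (t :: s2) (x :: B).
  case: (s2) adj s2B => [|t2 s3] neq_t2.
    by rewrite !sub1seq !inE orbA orbb.
  rewrite /=.
  case: (t =P x) => [Et|neq_tx] /=; last first.
    by move/eqP/negPf: neq_tx => ->.
  by case: (t2 =P x) => // Et2; rewrite /= Et Et2 eqxx in neq_t2.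
move=> s2B'; have /negP [] := nc _ _ neq_yz; rewrite Es.
exact: cat_subseq s1A s2B'.
Qed.

(** * Run weights *)

(** The current run has length [r] and ends with [x].  The letter 0 is a
    separator: it never continues a run and starts one of length 0. *)
Fixpoint run_weight_from (R : comNzRingType) (phi : nat -> R) (x r : nat)
    (w : seq nat) : R :=
  if w is y :: w' then
    if (0 < y < x)%N then run_weight_from phi y r.+1 w'
    else phi r * run_weight_from phi y (y != 0%N) w'
  else phi r.

Definition run_weight (R : comNzRingType) (phi : nat -> R) (w : seq nat) : R :=
  run_weight_from phi 0 0 w.

Lemma run_weight_nil (R : comNzRingType) (phi : nat -> R) :
  run_weight phi [::] = phi 0%N.
Proof. by []. Qed.

Lemma run_weight_cons (R : comNzRingType) (phi : nat -> R) x w :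
  phi 0%N = 1 -> run_weight phi (x :: w) = run_weight_from phi x (x != 0%N) w.
Proof. by move=> phi0; rewrite /run_weight /= ltn0 andbF phi0 mul1r. Qed.

Lemma run_weight_from_cat (R : comNzRingType) (phi : nat -> R) x r A B :
  phi 0%N = 1 -> ~~ (0 < head 0 B < last x A)%N ->
  run_weight_from phi x r (A ++ B) = run_weight_from phi x r A * run_weight phi B.
Proof.
move=> phi0; elim: A x r => [|y A IHA] x r /= brk; last first.
  by case: ifP => _; rewrite IHA // mulrA.
case: B brk => [|y B] /=; first by rewrite run_weight_nil phi0 mulr1.
by move/negbTE=> ->; rewrite run_weight_cons.
Qed.

Lemma run_weight_cat (R : comNzRingType) (phi : nat -> R) A B :
  phi 0%N = 1 -> ~~ (0 < head 0 B < last 0 A)%N ->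
  run_weight phi (A ++ B) = run_weight phi A * run_weight phi B.
Proof. by move=> phi0 brk; apply: run_weight_from_cat. Qed.

Lemma run_weight_cat0 (R : comNzRingType) (phi : nat -> R) A B :
  phi 0%N = 1 ->
  run_weight phi (A ++ 0%N :: B) = run_weight phi A * run_weight phi B.
Proof. by move=> phi0; rewrite run_weight_cat //= run_weight_cons. Qed.

(** Both 1 and 2 prolong the last run, unless [A] is empty or ends with 0 or 1,
    when neither does; a final 2 is the only letter that tells them apart. *)
Lemma run_weight_cat12 (R : comNzRingType) (phi : nat -> R) A :
  2%N \notin A -> run_weight phi (A ++ [:: 1%N]) = run_weight phi (A ++ [:: 2%N]).
Proof.
suff gen x r : x != 2%N -> 2%N \notin A ->
    run_weight_from phi x r (A ++ [:: 1%N]) =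
    run_weight_from phi x r (A ++ [:: 2%N]) by move/gen; apply.
elim: A x r => [|y A IHA] x r neq_x2 /=.
  by case: x neq_x2 => [|[|[]]].
rewrite inE negb_or eq_sym => /andP [neq_y2 A2].
by rewrite !(IHA y).
Qed.

Lemma run_weight_map (R : comNzRingType) (phi : nat -> R) (h : nat -> nat) w :
  {in w, forall x, (0 < h x)%N = (0 < x)%N} ->
  {in w &, forall x y, (h x < h y)%N = (x < y)%N} ->
  run_weight phi (map h w) = run_weight phi w.
Proof.
case: w => [|x w] // h0 hlt; rewrite /run_weight /= !ltn0 !andbF.
rewrite -!lt0n h0 ?mem_head //; congr (_ * _).
elim: w x (nat_of_bool _) h0 hlt => //= y w IHw x r h0 hlt.
have wS : {subset y :: w <= [:: x, y & w]} by move=> z zw; rewrite inE zw orbT.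
have IH : forall r, run_weight_from phi (h y) r (map h w) = run_weight_from phi y r w.
  by move=> t; apply: IHw => [z /wS /h0|z1 z2 /wS z1w /wS /(hlt _ _ z1w)].
rewrite -!lt0n h0 ?inE ?eqxx ?orbT // hlt ?inE ?eqxx ?orbT //.
by rewrite !IH.
Qed.

(** * Cutting a circular word *)

(** The form of a circular word on letters including 1 and 2 that is cut after
    a 1 whose closest predecessor among the 1s and 2s is a 2. *)
Definition rooted (u : seq nat) : Prop :=
  exists A B, u = A ++ 2%N :: B ++ [:: 1%N] /\ 1%N \notin B.

(** [u] is a rotation of [w] closed by a separator 0. *)
Definition cut_at0 (w u : seq nat) : Prop :=
  exists A B, w = B ++ A /\ u = A ++ 0%N :: B.

Lemma cut_at0_perm w u : cut_at0 w u -> perm_eq u (0%N :: w).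
Proof.
by case=> A [B [-> ->]]; rewrite perm_sym -cat_cons perm_catC.
Qed.

Lemma cut_at0_quasi_stirling w u :
  0%N \notin w -> cut_at0 w u -> quasi_stirling u = quasi_stirling w.
Proof.
move=> w0 [A [B [Ew ->]]]; rewrite Ew mem_cat orbC -mem_cat in w0 *.
rewrite -cat1s quasi_stirling_insert; last by move=> x; rewrite inE => /eqP ->.
rewrite [quasi_stirling (A ++ B)]quasi_stirling_catC andb_idl // => _.
by apply/quasi_stirlingP => x y _; apply/negP => /size_subseq.
Qed.

Lemma rooted_cut_exists w :
  1%N \in w -> 2%N \in w -> exists u, cut_at0 w u /\ rooted u.
Proof.
move=> w1 /split_first [P [Q [Ew _]]].
have : 1%N \in Q ++ 0%N :: P.
  by move: w1; rewrite Ew !mem_cat !inE /= orbC.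
case/split_first=> B [C [EB B1]]; exists (C ++ 2%N :: B ++ [:: 1%N]).
split; last by exists C, B.
have [] := @cat_cons_case _ 0%N 1%N _ _ _ _ isT EB.
  case=> E [EQ ->]; exists E, (P ++ 2%N :: B ++ [:: 1%N]).
  by split; rewrite ?Ew ?EQ -!catA //= -!catA.
case=> E [EB' EP]; exists (C ++ 2%N :: Q), (E ++ [:: 1%N]).
by split; rewrite ?Ew ?EP ?EB' -!catA //= -!catA.
Qed.

(** Among the letters 1 and 2, a 2 comes last; so it follows every 1. *)
Lemma mem_after_root C E F G : 1%N \notin E ->
  C ++ 2%N :: E = F ++ 1%N :: G -> 2%N \in G.
Proof.
move=> E1 /(@cat_cons_case _ 2%N 1%N _ _ _ _ isT) [] [D [_ EG]].
  by rewrite EG mem_cat mem_head orbT.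
by rewrite EG mem_cat mem_head orbT in E1.
Qed.

Lemma crossing A B C D E x y : x != y ->
  quasi_stirling (A ++ B ++ C ++ D ++ E) ->
  x \in A -> y \in B -> x \in C -> y \in D -> False.
Proof.
move=> neq /quasi_stirlingP /(_ _ _ neq) /negP nc xA yB xC yD; apply: nc.
rewrite -[[:: x; y; x; y]]/([:: x] ++ [:: y] ++ [:: x] ++ [:: y] ++ [::]).
by do 4![apply: cat_subseq; first by rewrite sub1seq]; exact: sub0seq.
Qed.

(** Two such cuts would yield the pattern 2 1 2 1 around the circle. *)
Lemma rooted_cut_inj w u1 u2 : 0%N \notin w -> quasi_stirling w ->
  cut_at0 w u1 -> cut_at0 w u2 -> rooted u1 -> rooted u2 -> u1 = u2.
Proof.
move=> w0 qs [A1 [B1 [Ew1 ->]]] [A2 [B2 [Ew2 ->]]].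
wlog le12 : A1 B1 A2 B2 Ew1 Ew2 / (size B1 <= size B2)%N.
  move=> IH; case/orP: (leq_total (size B1) (size B2)) => [/IH|/IH IH']; first exact.
  by move=> r1 r2; apply/esym/IH'.
have EB1 : B1 = take (size B1) B2.
  by rewrite -(takel_cat A2 le12) -Ew2 Ew1 take_size_cat.
pose D := drop (size B1) B2; have EB2 : B2 = B1 ++ D by rewrite {1}EB1 cat_take_drop.
have EA1 : A1 = D ++ A2.
  have /(congr1 (drop (size B1))) : B1 ++ A1 = B1 ++ (D ++ A2).
    by rewrite -Ew1 Ew2 EB2 catA.
  by rewrite !drop_size_cat.
rewrite {}EA1 {}EB2 in Ew2 *; have [->|] := eqVneq D [::]; first by rewrite cats0.
case/lastP: D Ew2 => // D z Ew2 _ [C1 [E1 [Eu1 E11]]] [C2 [E2 [Eu2 E21]]].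
move: Eu1 Eu2; rewrite !cats1 -!rcons_cat -!rcons_cons -!rcons_cat.
case/lastP: B1 Ew2 {Ew1 EB1 le12} => [|B0 t] Ew2.
  by rewrite cats1 => /rcons_inj [].
rewrite -!rcons_cons -!rcons_cat => /rcons_inj [/esym Eu1 Et].
move=> /rcons_inj [/esym Eu2 Ez]; subst t z.
have G1 : 2%N \in A2 ++ 0%N :: B0.
  by apply: (mem_after_root (C := C1) (F := D) E11); rewrite Eu1 -cats1 -!catA.
have D2 : 2%N \in D.
  apply: (mem_after_root (C := C2) (F := A2 ++ 0%N :: B0) E21).
  by rewrite Eu2 -cats1 -!catA.
exfalso; apply: (@crossing D [:: 1%N] (A2 ++ B0) [:: 1%N] [::] 2%N 1%N) => //.
  by move: qs; rewrite Ew2 -catA quasi_stirling_catC -!cats1 -!catA.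
by move: G1; rewrite !mem_cat inE.
Qed.

(** * Transferring a copy from 2 to 1 *)

(** The first 2 of a rooted word becomes a 1.  Here [X] is the gap where the 1s
    give way to the 2s and [Y] is the gap between the first two 2s.  The test
    [last 2 Z == 2] says that the last 2 is adjacent to the final 1. *)
Definition transfer (u u' : seq nat) : Prop :=
  exists P X Y Z,
    [/\ last 1%N P = 1%N, 2%N \notin P, 1%N \notin X ++ Y, 2%N \notin X ++ Y
      & 1%N \notin Z] /\
    u = P ++ X ++ 2%N :: Y ++ 2%N :: Z ++ [:: 1%N] /\
    u' = if last 2%N Z == 2%N then P ++ X ++ 1%N :: Y ++ 2%N :: Z ++ [:: 1%N]
         else P ++ Y ++ 1%N :: X ++ 2%N :: Z ++ [:: 1%N].

(** In a noncrossing rooted word all 1s but the last precede all 2s. *)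
Lemma rooted_split u : rooted u -> quasi_stirling u ->
  exists P X Z,
    [/\ last 1%N P = 1%N, 2%N \notin P, 1%N \notin X, 2%N \notin X
      & 1%N \notin Z] /\ u = P ++ X ++ 2%N :: Z ++ [:: 1%N].
Proof.
move=> [A [B [-> B1]]] qs.
have : 2%N \in A ++ 2%N :: B by rewrite mem_cat mem_head orbT.
case/split_first => P0 [Z [EB P02]].
have EU : A ++ 2%N :: B ++ [:: 1%N] = P0 ++ 2%N :: Z ++ [:: 1%N].
  by rewrite -[2%N :: B ++ _]/((2%N :: B) ++ _) catA EB -catA.
have [P [X [EP lastP X1]]] := split_last 1%N P0.
move: P02; rewrite EP mem_cat negb_or => /andP [P2 X2].
exists P, X, Z; rewrite EU EP -catA; split=> //; split=> //.
apply/negP => /split_first [Z1 [Z2 [EZ _]]].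
have Z22 : 2%N \in Z2.
  by apply: (mem_after_root (C := A) (F := P0 ++ 2%N :: Z1) B1); rewrite EB EZ -catA.
apply: (@crossing (P0 ++ [:: 2%N]) (Z1 ++ [:: 1%N]) Z2 [:: 1%N] [::] 2%N 1%N) => //.
- by move: qs; rewrite EU EZ -!catA /= -?catA.
- by rewrite mem_cat mem_head orbT.
by rewrite mem_cat mem_head orbT.
Qed.

Lemma transfer_inj_l u u' v' : transfer u u' -> transfer u v' -> u' = v'.
Proof.
move=> [P [X [Y [Z [[lP P2 XY1 XY2 Z1] [-> ->]]]]]].
move=> [Q [V [W [T [[lQ Q2 VW1 VW2 T1] [E ->]]]]]].
move: XY1 XY2 VW1 VW2 E; rewrite !mem_cat !negb_or.
move=> /andP [X1 Y1] /andP [X2 Y2] /andP [V1 W1] /andP [V2 W2].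
rewrite catA [RHS]catA => /cat_cons_inj []; rewrite ?mem_cat ?negb_or ?P2 ?Q2 //.
move=> /(last_cat_inj lP lQ X1 V1) [-> ->].
move=> /(cat_cons_inj Y2 W2) [->].
by rewrite !cats1 => /rcons_inj [->].
Qed.

Lemma transfer_inj_r u v u' : transfer u u' -> transfer v u' -> u = v.
Proof.
move=> [P [X [Y [Z [[lP P2 XY1 XY2 Z1] [-> ->]]]]]].
move=> [Q [V [W [T [[lQ Q2 VW1 VW2 T1] [-> E]]]]]].
move: XY1 XY2 VW1 VW2; rewrite !mem_cat !negb_or.
move=> /andP [X1 Y1] /andP [X2 Y2] /andP [V1 W1] /andP [V2 W2].
have main X' Y' V' W' : 1%N \notin X' -> 2%N \notin X' -> 1%N \notin Y' ->
    2%N \notin Y' -> 1%N \notin V' -> 2%N \notin V' -> 1%N \notin W' ->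
    2%N \notin W' ->
    P ++ X' ++ 1%N :: Y' ++ 2%N :: Z ++ [:: 1%N] =
    Q ++ V' ++ 1%N :: W' ++ 2%N :: T ++ [:: 1%N] ->
    [/\ P = Q, X' = V', Y' = W' & Z = T].
  move=> X'1 X'2 Y'1 Y'2 V'1 V'2 W'1 W'2.
  have assoc A B C D : A ++ B ++ 1%N :: C ++ 2%N :: D =
      ((A ++ B ++ [:: 1%N]) ++ C) ++ 2%N :: D by rewrite -!catA.
  rewrite !assoc => /cat_cons_inj [].
  - by rewrite !mem_cat !negb_or P2 X'2 Y'2.
  - by rewrite !mem_cat !negb_or Q2 V'2 W'2.
  rewrite !cats1 => EPQ /rcons_inj [EZT].
  have [||EPQ' ->] := last_cat_inj _ _ Y'1 W'1 EPQ.
  - by rewrite !last_cat last_rcons.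
  - by rewrite !last_cat last_rcons.
  move: EPQ'; rewrite -!rcons_cat => /rcons_inj [] /(last_cat_inj lP lQ X'1 V'1).
  by case=> -> ->.
case: ifP E => eZ; case: ifP => eT /main [] //.
- by move=> -> -> -> ->.
- by move=> _ _ _ EZ; rewrite EZ eT in eZ.
- by move=> _ _ _ EZ; rewrite EZ eT in eZ.
- by move=> -> -> -> ->.
Qed.

(** The extra [x] is cyclically adjacent to another [x]: the last letter of [P]
    or, if [P] is empty, the final letter. *)
Lemma quasi_stirling_dup_wrap P R x : last x P = x ->
  quasi_stirling (P ++ x :: R ++ [:: x]) = quasi_stirling (P ++ R ++ [:: x]).
Proof.
case/lastP: P => [_|P y] /=.
  by rewrite -cat1s quasi_stirling_catC -catA -[[:: x] ++ [:: x]]/[:: x; x]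
             quasi_stirling_dup.
by rewrite last_rcons => ->; rewrite cat_rcons quasi_stirling_dup cat_rcons.
Qed.

(** In either word each gap that is not shared has letters of its own, so it can
    be removed with [quasi_stirling_insert]; what remains on both sides differs
    by repetitions of adjacent equal letters. *)
Lemma transfer_quasi_stirling u u' :
  transfer u u' -> quasi_stirling u = quasi_stirling u'.
Proof.
move=> [P [X [Y [Z [[lP P2 XY1 XY2 Z1] [-> ->]]]]]].
move: XY1 XY2; rewrite !mem_cat !negb_or => /andP [X1 Y1] /andP [X2 Y2].
have ne (V : seq nat) a x : a \notin V -> x \in V -> x != a.
  by move=> aV xV; apply: contraNneq aV => <-.
have ne' (V : seq nat) a x : a \notin V -> x \in V -> a != x.
  by move=> aV xV; rewrite eq_sym (ne V).
have lastP1 x : x \in P -> x != 1%N -> exists2 P', P = rcons P' 1%N & x \in P'.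
  case/lastP: (P) lP => // P' y; rewrite last_rcons => -> + neq_x1.
  by rewrite mem_rcons inE (negPf neq_x1) => xP'; exists P'.
(* The gap after the last 2 is empty: X and Y both have letters of their own. *)
case: ifP => [/eqP lZ|_].
  have lastZ2 x : x \in Z -> x != 2%N -> exists2 Z', Z = rcons Z' 2%N & x \in Z'.
    case/lastP: (Z) lZ => // Z' y; rewrite last_rcons => -> + neq_x2.
    by rewrite mem_rcons inE (negPf neq_x2) => xZ'; exists Z'.
  pose closedX := forall x, x \in X -> x \notin P ++ Y ++ Z.
  pose closedY := forall y, y \in Y -> y \notin P ++ Z.
  have norm a : a \in [:: 1%N; 2%N] -> closedX -> closedY ->
      quasi_stirling (P ++ X ++ a :: Y ++ 2%N :: Z ++ [:: 1%N]) =
      [&& quasi_stirling X, quasi_stirling Y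
        & quasi_stirling (P ++ 2%N :: Z ++ [:: 1%N])].
    move=> ha cX cY; rewrite quasi_stirling_insert; last first.
      move=> x xX; move: (cX x xX) (ne _ _ _ X1 xX) (ne _ _ _ X2 xX).
      rewrite !(mem_cat, inE) !negb_or => /and3P [-> -> ->] x1 x2.
      by rewrite x1 x2 !andbT; move: ha; rewrite !inE => /orP [] /eqP ->.
    rewrite -[a :: _]cat1s catA quasi_stirling_insert; last first.
      move=> y yY; move: (cY y yY) (ne _ _ _ Y1 yY) (ne _ _ _ Y2 yY).
      rewrite !(mem_cat, inE) !negb_or => /andP [-> ->] y1 y2.
      by rewrite y1 y2 !andbT; move: ha; rewrite !inE => /orP [] /eqP ->.
    congr [&& _, _ & _]; rewrite -catA /=; move: ha; rewrite !inE.
    case/orP=> /eqP ->; last exact: quasi_stirling_dup.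
    by rewrite -[2%N :: _]/((2%N :: Z) ++ _) quasi_stirling_dup_wrap.
  have cl a : a \in [:: 1%N; 2%N] ->
      quasi_stirling (P ++ X ++ a :: Y ++ 2%N :: Z ++ [:: 1%N]) ->
      closedX /\ closedY.
    move=> ha qs.
    have aX x : x \in X -> x != a.
      by move: ha; rewrite !inE => /orP [] /eqP -> /ne; apply.
    have aY x : x \in Y -> x != a.
      by move: ha; rewrite !inE => /orP [] /eqP -> /ne; apply.
    have ha12 : a \in 2%N :: Z ++ [:: 1%N].
      by move: ha; rewrite !(inE, mem_cat) => /orP [] ->; rewrite ?orbT.
    have ha21 : a \in [:: 2%N; 1%N] by move: ha; rewrite !inE orbC.
    split=> [x xX|y yY]; rewrite !mem_cat; apply/negP.
      case/or3P=> [/lastP1 []|xY|/lastZ2 []].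
      + exact: ne xX.
      + move=> P' EP xP'.
        apply: (@crossing P' [:: 1%N] X (a :: Y ++ 2%N :: Z ++ [:: 1%N]) [::] x 1%N) => //.
        * exact: ne xX.
        * by move: qs; rewrite EP -cats1 -!catA cats0.
        by rewrite !(inE, mem_cat) !eqxx !orbT.
      + apply: (@crossing (P ++ X) [:: a] Y (2%N :: Z ++ [:: 1%N]) [::] x a) => //.
        * exact: aX.
        * by move: qs; rewrite -!catA cats0.
        * by rewrite mem_cat xX orbT.
        * exact: mem_head.
      + exact: ne xX.
      move=> Z' EZ xZ'.
      apply: (@crossing (P ++ X) [:: a] (Y ++ 2%N :: Z') [:: 2%N; 1%N] [::] x a) => //.
      * exact: aX.
      * by move: qs; rewrite EZ -cats1 -!catA /= -?catA.
      * by rewrite mem_cat xX orbT.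
      * exact: mem_head.
      by rewrite mem_cat inE xZ' !orbT.
    case/orP=> [/lastP1 []|/lastZ2 []].
    + exact: ne yY.
    + move=> P' EP yP'.
      apply: (@crossing P' [:: 1%N] (X ++ a :: Y) (2%N :: Z ++ [:: 1%N]) [::] y 1%N) => //.
      * exact: ne yY.
      * by move: qs; rewrite EP -cats1 -!catA cats0.
      * by rewrite mem_cat inE yY !orbT.
      by rewrite !(inE, mem_cat) !eqxx !orbT.
    + exact: ne yY.
    move=> Z' EZ yZ'.
    apply: (@crossing (P ++ X ++ a :: Y) [:: 2%N] Z' [:: 2%N; 1%N] [::] y 2%N) => //.
    * exact: ne yY.
    * by move: qs; rewrite EZ -cats1 -!catA /= -?catA.
    by rewrite !mem_cat inE yY !orbT.
  have hyp2 : 2%N \in [:: 1%N; 2%N] by [].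
  have hyp1 : 1%N \in [:: 1%N; 2%N] by [].
  apply/idP/idP => qs; first by have [cX cY] := cl _ hyp2 qs; rewrite norm // -(norm 2%N).
  by have [cX cY] := cl _ hyp1 qs; rewrite norm // -(norm 1%N).
(* Otherwise X may share letters with the gap after the last 2, and only Y can
   be removed. *)
pose closedY := forall y, y \in Y -> y \notin P ++ X ++ Z.
have dropY : closedY ->
    quasi_stirling (P ++ X ++ 2%N :: Y ++ 2%N :: Z ++ [:: 1%N]) =
    quasi_stirling (P ++ Y ++ 1%N :: X ++ 2%N :: Z ++ [:: 1%N]).
  move=> cY; rewrite [RHS]quasi_stirling_insert; last first.
    move=> y yY; move: (cY y yY) (ne _ _ _ Y1 yY) (ne _ _ _ Y2 yY).
    rewrite !(mem_cat, inE) !negb_or => /and3P [-> -> ->] y1 y2.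
    by rewrite y1 y2.
  rewrite -cat_rcons (catA P) quasi_stirling_insert; last first.
    move=> y yY; move: (cY y yY) (ne _ _ _ Y1 yY) (ne _ _ _ Y2 yY).
    rewrite !(mem_cat, inE, mem_rcons) !negb_or => /and3P [-> -> ->] y1 y2.
    by rewrite y1 y2.
  congr (_ && _); rewrite -catA cat_rcons (catA P) quasi_stirling_dup -catA.
  rewrite -[2%N :: Z ++ _]/((2%N :: Z) ++ _) (catA X).
  by rewrite quasi_stirling_dup_wrap.
apply/idP/idP => qs; [rewrite -dropY // | rewrite dropY //]; move=> y yY.
  rewrite catA mem_cat; apply/negP => /orP [yPX|yZ].
    apply: (@crossing (P ++ X) [:: 2%N] Y [:: 2%N] (Z ++ [:: 1%N]) y 2%N) => //.
      exact: ne yY.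
    by move: qs; rewrite -!catA.
  apply: (@crossing (P ++ X ++ [:: 2%N]) Y [:: 2%N] Z [:: 1%N] 2%N y) => //.
  - exact: ne' yY.
  - by move: qs; rewrite -!catA.
  by rewrite !mem_cat !inE !orbT.
rewrite mem_cat; apply/negP => /orP [/lastP1 []|yXZ].
- exact: ne yY.
- move=> P' EP yP'.
  apply: (@crossing P' [:: 1%N] Y (1%N :: X ++ 2%N :: Z ++ [:: 1%N]) [::] y 1%N) => //.
    exact: ne yY.
  by move: qs; rewrite EP -cats1 -!catA cats0.
apply: (@crossing (P ++ Y) [:: 1%N] (X ++ 2%N :: Z) [:: 1%N] [::] y 1%N) => //.
- exact: ne yY.
- by move: qs; rewrite -!catA.
- by rewrite mem_cat yY orbT.
by move: yXZ; rewrite !mem_cat inE => /orP [] ->; rewrite ?orbT.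
Qed.

(** Every run ends at the latest with a star, except that a 2 may be followed by
    the final 1; in that case the gaps keep their order, and otherwise the two
    exchanged gaps contribute independent factors. *)
Lemma transfer_run_weight (R : comNzRingType) (phi : nat -> R) u u' :
  phi 0%N = 1 -> transfer u u' -> run_weight phi u = run_weight phi u'.
Proof.
move=> phi0 [P [X [Y [Z [[lP P2 XY1 XY2 Z1] [-> ->]]]]]].
move: XY1 XY2; rewrite !mem_cat !negb_or => /andP [X1 Y1] /andP [X2 Y2].
have split1 (A B : seq nat) :
    run_weight phi (A ++ 1%N :: B) = run_weight phi (A ++ [:: 1%N]) * run_weight phi B.
  rewrite -cat1s catA run_weight_cat // last_cat /=.
  by case: (head _ _) => [|[]].
have split2 (A B : seq nat) : head 0%N B != 1%N ->
    run_weight phi (A ++ 2%N :: B) = run_weight phi (A ++ [:: 2%N]) * run_weight phi B.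
  move=> hB; rewrite -cat1s catA run_weight_cat // last_cat /=.
  by case: (head _ _) hB => [|[|[]]].
have splitP (B : seq nat) : run_weight phi (P ++ B) = run_weight phi P * run_weight phi B.
  apply: run_weight_cat => //; case/lastP: P lP {P2} => [|P' y]; first by rewrite /= ltn0 andbF.
  by rewrite !last_rcons => ->; case: (head _ _) => [|[]].
have headY : head 0%N (Y ++ 2%N :: Z ++ [:: 1%N]) != 1%N.
  by case: (Y) Y1 => //= y Y'; rewrite inE eq_sym negb_or => /andP [].
case: ifP => [_|lZ].
  by rewrite !splitP split2 // split1 run_weight_cat12.
have headZ : head 0%N (Z ++ [:: 1%N]) != 1%N.
  case: (Z) lZ Z1 => [|z Z'] /=; first by rewrite eqxx.
  by move=> _; rewrite inE eq_sym negb_or => /andP [].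
rewrite !splitP split1 (split2 X (Z ++ _)) // (split2 X (Y ++ _)) //.
by rewrite (split2 Y (Z ++ _)) // (run_weight_cat12 _ Y2); congr (_ * _); exact: mulrCA.
Qed.

Definition quasi_sum (R : comNzRingType) (phi : nat -> R) (s : seq nat) : R :=
  \sum_(w <- permutations s | quasi_stirling w) run_weight phi w.

Lemma transfer_exists u : rooted u -> quasi_stirling u ->
  (1 < count_mem 2%N u)%N -> exists2 u', transfer u u' & rooted u'.
Proof.
move=> ru qs; have [P [X [Z0 [[lP P2 X1 X2 Z01] Eu]]]] := rooted_split ru qs.
have nc a (V : seq nat) : a \notin V -> count_mem a V = 0%N by move/count_memPn.
rewrite Eu !count_cat /= !count_cat /= (nc _ _ P2) (nc _ _ X2) => cZ.
have /split_first [Y [Z [EZ Y2]]] : 2%N \in Z0. 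
  by move: cZ; rewrite !addn0 !add0n add1n ltnS -has_pred1 has_count.
move: Z01; rewrite EZ mem_cat inE !negb_or /= => /andP [Y1 Z1].
exists (if last 2%N Z == 2%N then P ++ X ++ 1%N :: Y ++ 2%N :: Z ++ [:: 1%N]
         else P ++ Y ++ 1%N :: X ++ 2%N :: Z ++ [:: 1%N]).
  exists P, X, Y, Z; rewrite !mem_cat !negb_or X1 X2 Y1 Y2; do !split=> //.
  by rewrite -catA.
case: ifP => _; [exists (P ++ X ++ 1%N :: Y), Z|exists (P ++ Y ++ 1%N :: X), Z];
  by rewrite -!catA.
Qed.

(** The gaps around the last 1 before the first 2 play the part that the gaps
    around the first 2 play in [transfer_exists]. *)
Lemma transfer_exists_inv u' : rooted u' -> quasi_stirling u' ->
  (1 < count_mem 1%N u')%N -> exists2 u, transfer u u' & rooted u.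
Proof.
move=> ru qs; have [P0 [X0 [Z [[lP0 P02 X01 X02 Z1] Eu]]]] := rooted_split ru qs.
have nc a (V : seq nat) : a \notin V -> count_mem a V = 0%N by move/count_memPn.
rewrite Eu !count_cat /= !count_cat /= (nc _ _ X01) (nc _ _ Z1) => cP.
case/lastP: P0 lP0 P02 Eu cP => // P1 y; rewrite last_rcons => ->.
rewrite mem_rcons inE negb_or /= => P12 Eu _.
have [P [V [EP lP V1]]] := split_last 1%N P1.
move: P12; rewrite EP mem_cat negb_or => /andP [P2 V2].
have [lZ|lZ] := boolP (last 2%N Z == 2%N).
  exists (P ++ V ++ 2%N :: X0 ++ 2%N :: Z ++ [:: 1%N]).
    exists P, V, X0, Z; rewrite lZ !mem_cat !negb_or X01 X02 V1 V2.
    by do !split=> //; rewrite cat_rcons -catA.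
  exists (P ++ V ++ 2%N :: X0), Z; by rewrite -!catA.
exists (P ++ X0 ++ 2%N :: V ++ 2%N :: Z ++ [:: 1%N]).
  exists P, X0, V, Z; rewrite (negPf lZ) !mem_cat !negb_or X01 X02 V1 V2.
  by do !split=> //; rewrite cat_rcons -catA.
by exists (P ++ X0 ++ 2%N :: V), Z; rewrite -!catA.
Qed.

Lemma transfer_perm u u' : transfer u u' -> perm_eq (2%N :: u') (1%N :: u).
Proof.
move=> [P [X [Y [Z [_ [-> ->]]]]]]; apply/permP => a.
by case: ifP => _; rewrite /= !count_cat /= !count_cat /= !count_cat /=; lia.
Qed.

Lemma cut_at0_exists u : 0%N \in u -> exists w, cut_at0 w u.
Proof. by case/split_first=> A [B [-> _]]; exists (B ++ A), A, B. Qed.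

(** The rooted word ends with 1, which ends a run, so the start of the word can
    be glued back after it. *)
Lemma cut_at0_run_weight (R : comNzRingType) (phi : nat -> R) w u :
  phi 0%N = 1 -> cut_at0 w u -> rooted u -> run_weight phi w = run_weight phi u.
Proof.
move=> phi0 [A [B [-> ->]]] [C [D [Eu _]]].
have lB : last 0%N B = 1%N.
  by have := congr1 (last 0%N) Eu; rewrite !last_cat /= last_cat.
rewrite run_weight_cat0 // mulrC run_weight_cat // lB.
by case: (head _ _) => [|[]].
Qed.

Lemma cut_at0_inj w1 w2 u : 0%N \notin w1 -> 0%N \notin w2 ->
  cut_at0 w1 u -> cut_at0 w2 u -> w1 = w2.
Proof.
move=> w10 w20 [A [B [Ew1 ->]]] [C [D [Ew2 EU]]]; move: w10 w20.
rewrite Ew1 Ew2 !mem_cat !negb_or => /andP [_ A0] /andP [_ C0].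
by have [-> ->] := cat_cons_inj A0 C0 EU.
Qed.

(** The bijection of the proof is the composite of closing [w] into a circle,
    [transfer], and reopening the circle at 0. *)
Lemma quasi_sum_transfer (R : comNzRingType) (phi : nat -> R) k1 k2 s :
  phi 0%N = 1 -> {in s, forall x, 2 < x}%N ->
  quasi_sum phi (nseq k1.+1 1%N ++ nseq k2.+2 2%N ++ s) =
  quasi_sum phi (nseq k1.+2 1%N ++ nseq k2.+1 2%N ++ s).
Proof.
move=> phi0 gt2; set s1 := nseq k1.+1 _ ++ _; set s2 := nseq k1.+2 _ ++ _.
have s0 : 0%N \notin s by apply/negP => /gt2.
have s1N0 w : perm_eq w s1 -> 0%N \notin w.
  by move/perm_mem->; rewrite !mem_cat !mem_nseq.
have s2N0 w : perm_eq w s2 -> 0%N \notin w.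
  by move/perm_mem->; rewrite !mem_cat !mem_nseq.
have perm12 w w' u u' : cut_at0 w u -> transfer u u' -> cut_at0 w' u' ->
    perm_eq w s1 = perm_eq w' s2.
  move=> /cut_at0_perm/permP wu /transfer_perm/permP uu' /cut_at0_perm/permP wu'.
  have s12 (a : pred nat) : (a 1%N + count a s1 = a 2%N + count a s2)%N.
    by rewrite /s1 /s2 !count_cat /=; lia.
  apply/permP/permP => pw a; have := pw a; move: (wu a) (wu' a) (uu' a) (s12 a);
    rewrite /=; lia.
pose rel w w' := exists u u',
  [/\ cut_at0 w u, rooted u, transfer u u', rooted u' & cut_at0 w' u'].
rewrite /quasi_sum -!(big_filter (permutations _)).
apply: (eq_sum_rel (rel := rel)); try exact: filter_uniq (permutations_uniq _).
- move=> w; rewrite mem_filter mem_permutations => /andP [qw pw].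
  have [] := @rooted_cut_exists w.
  + by rewrite (perm_mem pw) mem_head.
  + by rewrite (perm_mem pw) !mem_cat !mem_nseq /= ?orbT.
  move=> u [wu ru].
  have qu : quasi_stirling u by rewrite (cut_at0_quasi_stirling _ wu) // s1N0.
  have [] := transfer_exists ru qu.
    by rewrite (permP (cut_at0_perm wu)) /= (permP pw) !count_cat !count_nseq /=; lia.
  move=> u' uu' ru'.
  have [] := @cut_at0_exists u'.
    have /perm_mem /(_ 0%N) := transfer_perm uu'; rewrite !inE /= => ->.
    by rewrite (perm_mem (cut_at0_perm wu)) mem_head.
  move=> w' wu'; have pw' : perm_eq w' s2 by rewrite -(perm12 w _ u u').
  exists w'; last by exists u, u'.
  rewrite mem_filter mem_permutations pw' andbT.
  by rewrite -(cut_at0_quasi_stirling _ wu') ?s2N0 // -(transfer_quasi_stirling uu').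
- move=> w'; rewrite mem_filter mem_permutations => /andP [qw' pw'].
  have [] := @rooted_cut_exists w'.
  + by rewrite (perm_mem pw') mem_head.
  + by rewrite (perm_mem pw') !mem_cat !mem_nseq /= ?orbT.
  move=> u' [wu' ru'].
  have qu' : quasi_stirling u' by rewrite (cut_at0_quasi_stirling _ wu') // s2N0.
  have [] := transfer_exists_inv ru' qu'.
    by rewrite (permP (cut_at0_perm wu')) /= (permP pw') !count_cat !count_nseq /=; lia.
  move=> u uu' ru.
  have [] := @cut_at0_exists u.
    have /perm_mem /(_ 0%N) := transfer_perm uu'; rewrite !inE /= => <-.
    by rewrite (perm_mem (cut_at0_perm wu')) mem_head.
  move=> w wu; have pw : perm_eq w s1 by rewrite (perm12 _ w' u u').
  exists w; last by exists u, u'.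
  rewrite mem_filter mem_permutations pw andbT.
  by rewrite -(cut_at0_quasi_stirling _ wu) ?s1N0 // (transfer_quasi_stirling uu').
- move=> w w1 w2; rewrite !mem_filter !mem_permutations.
  move=> /andP [qw pw] /andP [qw1 pw1] /andP [qw2 pw2].
  move=> [u1 [u1' [wu1 ru1 uu1 _ wu1']]] [u2 [u2' [wu2 ru2 uu2 _ wu2']]].
  have Eu := rooted_cut_inj (s1N0 _ pw) qw wu1 wu2 ru1 ru2; rewrite -Eu in uu2.
  have Eu' := transfer_inj_l uu1 uu2; rewrite -Eu' in wu2'.
  exact: cut_at0_inj (s2N0 _ pw1) (s2N0 _ pw2) wu1' wu2'.
- move=> w1 w2 w; rewrite !mem_filter !mem_permutations.
  move=> /andP [qw1 pw1] /andP [qw2 pw2] /andP [qw pw].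
  move=> [u1 [u1' [wu1 _ uu1 ru1' wu1']]] [u2 [u2' [wu2 _ uu2 ru2' wu2']]].
  have Eu' := rooted_cut_inj (s2N0 _ pw) qw wu1' wu2' ru1' ru2'.
  rewrite -Eu' in uu2; have Eu := transfer_inj_r uu1 uu2; rewrite -Eu in wu2.
  exact: cut_at0_inj (s1N0 _ pw1) (s1N0 _ pw2) wu1 wu2.
move=> w w' _ _ [u [u' [wu ru uu' ru' wu']]].
rewrite (cut_at0_run_weight phi0 wu ru) (transfer_run_weight phi0 uu').
by rewrite (cut_at0_run_weight phi0 wu' ru').
Qed.

(** * Relabelling letters *)
Lemma perm_eq_map_exists (h : nat -> nat) s w :
  perm_eq w (map h s) -> exists2 v, w = map h v & perm_eq v s.
Proof.
case/(perm_iotaP 0%N) => Is; rewrite size_map => pIs ->.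
exists (map (nth 0%N s) Is).
  rewrite -map_comp; apply/eq_in_map => i; rewrite (perm_mem pIs) mem_iota add0n.
  by move=> /andP [_ lti] /=; rewrite (nth_map 0%N).
by apply/(perm_iotaP 0%N); exists Is.
Qed.

Lemma sum_permutations_map (V : nmodType) (h : nat -> nat) s (F : seq nat -> V) :
  {in s &, injective h} ->
  \sum_(w <- permutations (map h s)) F w =
  \sum_(w <- permutations s) F (map h w).
Proof.
move=> inj_h; apply: (eq_sum_rel (rel := fun w v => w = map h v)).
- exact: permutations_uniq.
- exact: permutations_uniq.
- move=> w; rewrite mem_permutations => /perm_eq_map_exists [v -> pv].
  by exists v; rewrite ?mem_permutations.
- move=> v; rewrite mem_permutations => pv; exists (map h v) => //.
  by rewrite mem_permutations perm_map.
- move=> w v v' _; rewrite !mem_permutations => pv pv' ->.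
  apply: (inj_in_map (A := mem s)) => //.
  + by apply/allP => x; rewrite (perm_mem pv).
  + by apply/allP => x; rewrite (perm_mem pv').
- by move=> w w' v _ _ _ -> ->.
by move=> w v _ _ ->.
Qed.

Lemma quasi_stirling_map (h : nat -> nat) w :
  {in w &, injective h} -> quasi_stirling (map h w) = quasi_stirling w.
Proof.
move=> inj_h; apply/quasi_stirlingP/quasi_stirlingP => nc x y neq_xy.
  apply/negP => sxy; have xw : x \in w by apply: mem_subseq sxy _ _; rewrite !inE eqxx.
  have yw : y \in w by apply: mem_subseq sxy _ _; rewrite !inE eqxx orbT.
  have neq_h : h x != h y by apply: contraNneq neq_xy => Eh; rewrite (inj_h x y).
  exact: (negP (nc _ _ neq_h)) (map_subseq h sxy).
apply/negP => /subseqP [m]; rewrite size_map => sm; rewrite -map_mask.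
have : subseq (mask m w) w by apply: mask_subseq.
case: (mask m w) => [|a [|b [|c [|d [|e t]]]]] //= sw [] Ea Eb Ec Ed.
have mw z : z \in [:: a; b; c; d] -> z \in w by apply: mem_subseq sw _.
have Eac : a = c by apply: inj_h; rewrite ?mw ?inE ?eqxx ?orbT // -Ea.
have Ebd : b = d by apply: inj_h; rewrite ?mw ?inE ?eqxx ?orbT // -Eb.
rewrite -Eac -Ebd in sw; have neq_ab : a != b.
  by apply: contraNneq neq_xy => Eab; rewrite Ea Eb Eab.
exact: (negP (nc _ _ neq_ab)) sw.
Qed.

Lemma quasi_sum_map (R : comNzRingType) (phi : nat -> R) (h : nat -> nat) s :
  {in s, forall x, (0 < h x)%N = (0 < x)%N} ->
  {in s &, forall x y, (h x < h y)%N = (x < y)%N} ->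
  quasi_sum phi (map h s) = quasi_sum phi s.
Proof.
move=> h0 hlt; have inj_h : {in s &, injective h}.
  by move=> x y xs ys Eh; have := hlt _ _ xs ys; have := hlt _ _ ys xs; rewrite Eh ltnn; lia.
rewrite /quasi_sum big_mkcond [RHS]big_mkcond sum_permutations_map //=.
apply: eq_big_seq => w; rewrite mem_permutations => pw.
rewrite quasi_stirling_map; last first.
  by move=> x y; rewrite !(perm_mem pw); apply: inj_h.
rewrite run_weight_map // => [x|x y]; rewrite !(perm_mem pw).
  exact: h0.
exact: hlt.
Qed.

(** * Removing a letter that is smallest and single *)
Definition insert1 (i : nat) (w : seq nat) := take i w ++ 1%N :: drop i w.

(** A single letter crosses nothing, so the insertion is unrestricted. *)
Lemma quasi_sum_insert1 (R : comNzRingType) (phi : nat -> R) s :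
  1%N \notin s ->
  quasi_sum phi (1%N :: s) =
  \sum_(v <- permutations s | quasi_stirling v)
    \sum_(i < (size v).+1) run_weight phi (insert1 i v).
Proof.
move=> s1; pose N := size s.
rewrite /quasi_sum -!(big_filter (permutations _)).
set r2 := filter _ (permutations s).
transitivity (\sum_(v <- r2) \sum_(i <- iota 0 N.+1) run_weight phi (insert1 i v));
  last first.
  apply: eq_big_seq => v; rewrite mem_filter mem_permutations => /andP [_ pv].
  by rewrite (perm_size pv) -/N -(big_mkord xpredT (fun i => run_weight phi (insert1 i v))).
rewrite -(big_allpairs (F := fun vi => run_weight phi (insert1 vi.2 vi.1))).
have memP (vi : seq nat * nat) :
    vi \in [seq (v, i) | v <- r2, i <- iota 0 N.+1] ->
    [/\ quasi_stirling vi.1, perm_eq vi.1 s & (vi.2 <= N)%N].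
  case/allpairsP => -[v i] []; rewrite mem_filter mem_permutations mem_iota.
  by move=> /andP [qv pv] /andP [_ lei] ->.
apply: (eq_sum_rel (rel := fun w vi => w = insert1 vi.2 vi.1)).
- exact: filter_uniq (permutations_uniq _).
- apply: allpairs_uniq; rewrite ?filter_uniq ?permutations_uniq ?iota_uniq //.
  by move=> [v i] [v' i'] _ _ [-> ->].
- move=> w; rewrite mem_filter mem_permutations => /andP [qw pw].
  have /split_first [A [B [Ew A1]]] : 1%N \in w by rewrite (perm_mem pw) mem_head.
  have pAB : perm_eq (A ++ B) s.
    by move: pw; rewrite Ew -cat1s perm_catCA /= perm_cons.
  exists (A ++ B, size A); last by rewrite /insert1 /= take_size_cat // drop_size_cat.
  apply/allpairsP; exists (A ++ B, size A); split=> //.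
    rewrite mem_filter mem_permutations pAB andbT.
    by move: qw; apply: quasi_stirling_subseq; rewrite Ew subseq_cat2l subseq_cons.
  by rewrite mem_iota /N -(perm_size pAB) size_cat /= add0n ltnS leq_addr.
- move=> [v i] /memP [/= qv pv lei]; exists (insert1 i v) => //.
  rewrite mem_filter mem_permutations /insert1; apply/andP; split.
    rewrite -cat1s quasi_stirling_insert cat_take_drop ?qv ?andbT.
      by apply/quasi_stirlingP => x y _; apply/negP => /size_subseq.
    by move=> x; rewrite inE => /eqP ->; rewrite (perm_mem pv).
  by rewrite -[_ :: drop _ _]cat1s perm_catCA /= perm_cons cat_take_drop.
- move=> w [v i] [v' i'] _ /memP [/= _ pv lei] /memP [/= _ pv' lei'] -> Ev.
  have v1 u j : perm_eq u s -> 1%N \notin take j u.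
    by move=> pu; apply: contra s1 => /mem_take; rewrite (perm_mem pu).
  have [Et Ed] := cat_cons_inj (v1 v i pv) (v1 v' i' pv') Ev.
  have -> : v = v' by rewrite -(cat_take_drop i v) Et Ed cat_take_drop.
  have := congr1 size Et; rewrite !size_takel ?(perm_size pv) ?(perm_size pv') //.
  by move=> ->.
- by move=> w w' [v i] _ _ _ -> ->.
by move=> w [v i] _ _ ->.
Qed.

(** With e = ['X] and e^2 neglected, phi_r + e * (sum over the positions i >= 1
    of the effect of inserting a letter 1 after the i-th letter of a run of
    length r, which cuts it into runs of lengths i + 1 and r - i).  Insertion at
    the very start of the word is the only one this misses. *)
Definition peeled (R : comNzRingType) (phi : nat -> R) (r : nat) : {poly R} :=
  (phi r)%:P + (\sum_(1 <= i < r.+1) phi i.+1 * phi (r - i)%N)%:P * 'X.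

Lemma peeled_coef0 (R : comNzRingType) (phi : nat -> R) r : (peeled phi r)`_0 = phi r.
Proof. by rewrite coefD coefMX coefC addr0. Qed.

Lemma peeled_coef1 (R : comNzRingType) (phi : nat -> R) r :
  (peeled phi r)`_1 = \sum_(1 <= i < r.+1) phi i.+1 * phi (r - i)%N.
Proof. by rewrite coefD coefMX !coefC /= add0r. Qed.

Lemma coef1M (R : comNzRingType) (p q : {poly R}) :
  (p * q)`_1 = p`_0 * q`_1 + p`_1 * q`_0.
Proof. by rewrite coefM !big_ord_recl big_ord0 addr0. Qed.

Lemma peeled_run_weight_from0 (R : comNzRingType) (phi : nat -> R) x r w :
  (run_weight_from (peeled phi) x r w)`_0 = run_weight_from phi x r w.
Proof.
elim: w x r => [|y w IHw] x r /=; first exact: peeled_coef0.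
by case: ifP => _ //; rewrite coef0M peeled_coef0 IHw.
Qed.

(** The second sum accounts for the insertions into the [r - 1] earlier places of
    the run in progress, which the weight over dual numbers sees as well. *)
Lemma peeled_run_weight_from1 (R : comNzRingType) (phi : nat -> R) x r w :
  phi 0%N = 1 -> (1 < x)%N -> (0 < r)%N -> {in w, forall y, 1 < y}%N ->
  (run_weight_from (peeled phi) x r w)`_1 =
  \sum_(i < (size w).+1) run_weight_from phi x r (insert1 i w) +
  \sum_(1 <= i < r) phi i.+1 * run_weight_from phi x (r - i) w.
Proof.
move=> phi0; elim: w x r => [|y w IHw] x r gt1x gt0r gt1w.
  by rewrite big_ord1 /= gt1x peeled_coef1 big_nat_recr //= subnn phi0 mulr1 addrC.
have gt1y : (1 < y)%N by rewrite gt1w ?mem_head.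
have {}IHw t : (0 < t)%N -> _ := fun t0 => IHw y t gt1y t0 _.
have gt1w' : {in w, forall y, 1 < y}%N by move=> z zw; rewrite gt1w // inE zw orbT.
have y0 : (y != 0%N) = true by case: (y) gt1y.
have insert10 : insert1 (@ord0 (size w).+1) (y :: w) = [:: 1%N, y & w] by [].
rewrite big_ord_recl insert10 /= gt1x.
rewrite (ltnNge y 1) (ltnW gt1y) /= y0.
have [ltyx|lexy] := ltnP y x.
  rewrite [X in _ = _ + X + _](_ : _ =
    \sum_(i < (size w).+1) run_weight_from phi y r.+1 (insert1 i w)) //.
  have -> : \sum_(1 <= i < r) phi i.+1 * run_weight_from phi y (r - i).+1 w =
      \sum_(1 <= i < r) phi i.+1 * run_weight_from phi y (r.+1 - i) w.
    rewrite big_nat_cond [RHS]big_nat_cond; apply: eq_bigr => i /andP [/andP [_ ltir] _].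
    by rewrite subSn // ltnW.
  by rewrite IHw // big_nat_recr //= subSn // subnn; ring.
rewrite [X in _ = _ + X + _](_ : _ =
  phi r * \sum_(i < (size w).+1) run_weight_from phi y 1 (insert1 i w)); last first.
  by rewrite big_distrr.
rewrite coef1M peeled_coef0 peeled_coef1 peeled_run_weight_from0 IHw //.
rewrite [\sum_(1 <= i < 1) _]big_geq // addr0 big_nat_recr //= subnn phi0 mulr1.
under [X in _ = _ + X]eq_bigr do rewrite mulrA.
by rewrite -big_distrl /=; ring.
Qed.

(** The first summand is the insertion at the start, where 1 is a run by
    itself. *)
Lemma quasi_sum_smallest (R : comNzRingType) (phi : nat -> R) s :
  phi 0%N = 1 -> {in s, forall x, 1 < x}%N ->
  quasi_sum phi (1%N :: s) =
  phi 1%N * quasi_sum phi s + (quasi_sum (peeled phi) s)`_1.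
Proof.
move=> phi0 gt1; rewrite quasi_sum_insert1; last by apply/negP => /gt1.
have peeled0 : peeled phi 0%N = 1.
  by rewrite /peeled phi0 big_geq // mul0r addr0.
rewrite /quasi_sum coef_sum big_distrr -big_split /= big_seq_cond [RHS]big_seq_cond.
apply: eq_bigr => w; rewrite mem_permutations => /andP [pw _].
have {gt1 pw} gt1 : {in w, forall x, 1 < x}%N by move=> x; rewrite (perm_mem pw) => /gt1.
case: w gt1 => [|x w] gt1.
  rewrite big_ord1 !run_weight_nil peeled0 coef1 addr0 phi0 mulr1.
  by rewrite run_weight_cons //= .
have gt1x : (1 < x)%N by rewrite gt1 ?mem_head.
have x0 : (x != 0%N) = true by case: (x) gt1x.
have insert10 : insert1 (@ord0 (size w).+1) (x :: w) = [:: 1%N, x & w] by [].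
rewrite big_ord_recl insert10 !run_weight_cons // x0 peeled_run_weight_from1 //; last first.
  by move=> y yw; rewrite gt1 // inE yw orbT.
rewrite big_geq // addr0; congr (_ + _).
  by rewrite /= (ltnNge x 1) (ltnW gt1x) andbF x0.
apply: eq_bigr => i _; have := run_weight_cons x (insert1 i w) phi0.
by rewrite x0 => <-.
Qed.

(** * Uniformity of the quasi-Stirling sums *)

(** The letters of the tail are shifted, so that removing the smallest letter
    leaves, up to [map S], a word of the same shape. *)
Fixpoint mword (ks : seq nat) : seq nat :=
  if ks is k :: ks' then nseq k 1%N ++ map S (mword ks') else [::].

Lemma mword_gt0 ks : {in mword ks, forall x, 0 < x}%N.
Proof.
elim: ks => [|k ks _] x //=; rewrite mem_cat mem_nseq.
by case/orP => [/andP [_ /eqP ->] //|/mapP [y _ ->]].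
Qed.

Lemma quasi_sum_mapS (R : comNzRingType) (phi : nat -> R) s :
  {in s, forall x, 0 < x}%N -> quasi_sum phi (map S s) = quasi_sum phi s.
Proof. by move=> gt0; apply: quasi_sum_map => // x /gt0 ->. Qed.

Lemma mapS_mword_gt1 ks : {in map S (mword ks), forall x, 1 < x}%N.
Proof. by move=> x /mapP [y /mword_gt0 y0 ->]. Qed.

Lemma quasi_sum_merge (R : comNzRingType) (phi : nat -> R) k1 k2 ks :
  phi 0%N = 1 -> (0 < k1)%N -> (0 < k2)%N ->
  quasi_sum phi (mword [:: k1, k2 & ks]) =
  quasi_sum phi (mword [:: 1%N, (k1 + k2).-1 & ks]).
Proof.
move=> phi0; case: k1 k2 => // k1 [] // k2 _ _.
rewrite addSn -pred_Sn; elim: k1 k2 => [|k1 IHk] k2; first by [].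
have mwordE k k' : mword [:: k, k' & ks] =
    nseq k 1%N ++ nseq k' 2%N ++ map S (map S (mword ks)).
  by rewrite /= map_cat map_nseq.
rewrite addSnnS -IHk !mwordE; apply/esym/quasi_sum_transfer => //.
by move=> x /mapP [y /mapS_mword_gt1 y0 ->].
Qed.

Lemma quasi_sum_peel (R : comNzRingType) (phi : nat -> R) ks :
  phi 0%N = 1 ->
  quasi_sum phi (mword (1%N :: ks)) =
  phi 1%N * quasi_sum phi (mword ks) + (quasi_sum (peeled phi) (mword ks))`_1.
Proof.
move=> phi0; rewrite quasi_sum_smallest //; last exact: mapS_mword_gt1.
by rewrite !quasi_sum_mapS //; apply: mword_gt0.
Qed.

(** The ring and [phi] vary in the induction, since peeling replaces them by
    [{poly R}] and [peeled phi]. *)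
Lemma quasi_sum_uniform (n : nat) (R : comNzRingType) (phi : nat -> R) ks :
  phi 0%N = 1 -> size ks = n.+1 -> {in ks, forall k, 0 < k}%N ->
  quasi_sum phi (mword ks) =
  quasi_sum phi (mword ((sumn ks - n)%N :: nseq n 1%N)).
Proof.
elim: n R phi ks => [|n IHn] R phi ks phi0.
  by case: ks => [|k []] //= _ _; rewrite addn0 subn0.
case: ks => [|k1 [|k2 ks]] // [size_ks] gt0.
have gt0k1 : (0 < k1)%N by rewrite gt0 ?inE ?eqxx.
have gt0k2 : (0 < k2)%N by rewrite gt0 ?inE ?eqxx ?orbT.
have le_size : (size ks <= sumn ks)%N.
  have {}gt0 : {in ks, forall k, 0 < k}%N by move=> k kks; rewrite gt0 // !inE kks !orbT.
  by elim: (ks) gt0 => //= k ks' IH gt0; have := gt0 k (mem_head _ _);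
    have := IH (fun z zs => gt0 z (@mem_behead _ (k :: ks') z zs)); lia.
rewrite size_ks in le_size.
have peeled0 : peeled phi 0%N = 1 by rewrite /peeled phi0 big_geq // mul0r addr0.
rewrite quasi_sum_merge // [RHS]quasi_sum_merge //; last first.
  by rewrite /=; lia.
have IH (S : comNzRingType) (psi : nat -> S) : psi 0%N = 1 ->
    quasi_sum psi (mword ((k1 + k2).-1 :: ks)) =
    quasi_sum psi (mword ((sumn [:: k1, k2 & ks] - n.+1 + 1).-1 :: nseq n 1%N)).
  move=> psi0; rewrite IHn //=; last first.
  - move=> k; rewrite inE => /predU1P [->|kks]; first by lia.
    by rewrite gt0 // !inE kks !orbT.
  - by rewrite size_ks.
  by congr (quasi_sum _ (nseq _ _ ++ _)); lia.
by rewrite !quasi_sum_peel // !IH.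
Qed.

(** * The first run *)
Fixpoint run_length (x : nat) (w : seq nat) : nat :=
  if w is y :: w' then if (y < x)%N then (run_length y w').+1 else 1 else 1.

Lemma run_length_gt0 x w : (0 < run_length x w)%N.
Proof. by case: w => //= y w; case: ifP. Qed.

Lemma run_length_leq_size x w : (run_length x w <= (size w).+1)%N.
Proof. by elim: w x => //= y w IHw x; case: ifP => // _; rewrite ltnS. Qed.

Lemma run_lengthP x w s :
  reflect ((s <= size w)%N /\
           forall i, (i < s)%N -> (nth 0 (x :: w) i.+1 < nth 0 (x :: w) i)%N)
          (s < run_length x w)%N.
Proof.
elim: w x s => [|y w IHw] x [|s];
  try by rewrite run_length_gt0; constructor.
  by constructor; case.
apply: (iffP idP) => /= [|[]].
  case: ifP => // ltyx; rewrite ltnS => /IHw [lesw dec]; split=> // -[|i] //=.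
  by rewrite ltnS; apply: dec.
rewrite ltnS => lesw dec; rewrite (dec 0%N) // ltnS; apply/IHw; split=> // i ltis.
exact: (dec i.+1).
Qed.

Lemma sorted_take_run_length x w m : (m <= (size w).+1)%N ->
  sorted gtn (take m (x :: w)) = (m <= run_length x w)%N.
Proof.
case: m => // m; rewrite ltnS /=.
elim: w x m => [|y w IHw] x [|m]; rewrite ?take0 ?run_length_gt0 //.
by rewrite /= ltnS => lemw; rewrite IHw //; case: ltnP.
Qed.

Lemma run_weight_from_first_run (R : comNzRingType) (phi : nat -> R) x r w :
  phi 0%N = 1 -> {in w, forall y, 0 < y}%N ->
  run_weight_from phi x r.+1 w =
  phi (r + run_length x w)%N * run_weight phi (drop (run_length x w).-1 w).
Proof.
move=> phi0; elim: w x r => [|y w IHw] x r gt0.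
  by rewrite /= addn1 run_weight_nil phi0 mulr1.
have gt0y : (0 < y)%N by rewrite gt0 ?mem_head.
have gt0w : {in w, forall y, 0 < y}%N by move=> z zw; rewrite gt0 // inE zw orbT.
have y0 : (y != 0%N) = true by rewrite -lt0n.
rewrite /= gt0y /=; case: ifP => _; last first.
  by rewrite addn1 /= run_weight_cons // y0.
rewrite IHw // addSnnS /=; congr (_ * run_weight phi _).
by case: run_length (run_length_gt0 y w).
Qed.

Lemma run_weight_drop (R : comNzRingType) (phi : nat -> R) x w m :
  phi 0%N = 1 -> (0 < x)%N -> {in w, forall y, 0 < y}%N ->
  (m <= run_length x w)%N ->
  run_weight phi (drop m (x :: w)) =
  phi (run_length x w - m)%N * run_weight phi (drop (run_length x w) (x :: w)).
Proof.
move=> phi0 gt0x gt0; elim: w x m gt0x gt0 => [|y w IHw] x [|m] gt0x gt0 lem.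
- by rewrite drop0 subn0 run_weight_cons // -lt0n gt0x /= run_weight_nil phi0 mulr1.
- by move: lem => /=; case: m => // _; rewrite /= phi0 mul1r.
- rewrite drop0 subn0 run_weight_cons // -lt0n gt0x run_weight_from_first_run // add0n.
  by case: run_length (run_length_gt0 x (y :: w)).
move: lem; rewrite [run_length _ _]/=; case: ifP => _; last first.
  by rewrite ltnS leqn0 => /eqP ->; rewrite subnn phi0 mul1r.
rewrite ltnS subSS /= => lem; rewrite -IHw //; first by rewrite gt0 ?mem_head.
by move=> z zw; rewrite gt0 // inE zw orbT.
Qed.

(** Writing the word as its first run followed by [v], each summand is
    W_m phi_(r-m) times the weight of [v], where r is the length of that run. *)
Lemma run_weight_rec (R : comNzRingType) (phi W : nat -> R) w :
  phi 0%N = 1 ->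
  (forall r, (0 < r)%N -> phi r = \sum_(1 <= m < r.+1) W m * phi (r - m)%N) ->
  w != [::] -> {in w, forall x, 0 < x}%N ->
  run_weight phi w =
  \sum_(1 <= m < (size w).+1 | sorted gtn (take m w)) W m * run_weight phi (drop m w).
Proof.
move=> phi0 phiW; case: w => // x w _ gt0.
have gt0x : (0 < x)%N by rewrite gt0 ?mem_head.
have gt0w : {in w, forall y, 0 < y}%N by move=> z zw; rewrite gt0 // inE zw orbT.
have := @run_weight_drop R phi x w 0 phi0 gt0x gt0w (leq0n _).
rewrite drop0 subn0 => ->; rewrite phiW ?run_length_gt0 // mulr_suml.
rewrite (big_nat_widen _ _ (size w).+2); last exact: run_length_leq_size.
rewrite big_nat_cond [RHS]big_nat_cond; apply: eq_big => m.
  apply: andb_id2l => /andP [_]; rewrite ltnS => lems.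
  by rewrite /= sorted_take_run_length // ltnS.
move=> /and3P [_ _]; rewrite ltnS => lem.
by rewrite (run_weight_drop phi0 gt0x gt0w lem) mulrA.
Qed.

(** * The statistic as a run weight *)
Lemma consec_decr_cons s x w : (0 < s)%N ->
  consec_decr s (x :: w) = ((s <= run_length x w) + consec_decr s w)%N.
Proof.
case: s => // s _; rewrite /consec_decr /= !subSS.
have [lesw|ltws] := leqP s (size w); last first.
  have -> : (s < run_length x w)%N = false.
    by apply/negP => /run_lengthP [lesw _]; rewrite leqNgt ltws in lesw.
  have -> : ((size w).+1 - s = 0)%N by apply/eqP; rewrite subn_eq0.
  by have -> : (size w - s = 0)%N by apply/eqP; rewrite subn_eq0; exact: ltnW.
rewrite subSn //= -[1%N]addn0 iotaDl count_map; congr (nat_of_bool _ + _)%N.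
  apply/forallP/run_lengthP => [dec|[_ dec] i]; last exact: (dec i (ltn_ord i)).
  by split=> // i ltis; apply: (dec (Ordinal ltis)).
Qed.

Lemma run_seriesE s r : run_series s r = 'X^(r.+1 - s).
Proof.
rewrite /=; case: ltnP => [ltrs|lesr]; last by rewrite subSn // addn1.
by rewrite (eqP (_ : (r.+1 - s)%N == 0%N)) ?expr0 ?subn_eq0.
Qed.

Lemma run_weight_consec s w : (0 < s)%N -> {in w, forall x, 0 < x}%N ->
  run_weight (run_series s) w = 'X^(consec_decr s w).
Proof.
move=> s0; have phi0 : run_series s 0 = 1 by rewrite /= s0.
have := run_seriesE s; move: (coef_fps (run_series s)) phi0 => phi phi0 phiE.
(* For a run in progress with r letters before x, the exponent N exceeds the
   statistic of x :: v by what these r letters add to the first run. *)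
suff gen x r v : {in v, forall x, 0 < x}%N ->
    exists2 N, run_weight_from phi x r.+1 v = 'X^N &
      (N + ((run_length x v).+1 - s) =
       consec_decr s (x :: v) + (r + (run_length x v).+1 - s))%N.
  case: w => [|x w] gt0.
    by rewrite run_weight_nil phi0 /consec_decr /=; case: (s) s0 => // t; rewrite subSS sub0n.
  have gt0x : (0 < x)%N by rewrite gt0 ?mem_head.
  have [|N EN] := gen x 0%N w; first by move=> z zw; rewrite gt0 // inE zw orbT.
  rewrite add0n => /addIn <-.
  by rewrite run_weight_cons // -lt0n gt0x EN.
elim: v x r => [|y v IHv] x r gt0.
  exists (r.+2 - s)%N; first exact: phiE.
  rewrite consec_decr_cons //= addnC; congr (_ + _)%N; last by rewrite addn2.
  by rewrite /consec_decr /=; case: (s) s0 => [|[|t]].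
have gt0y : (0 < y)%N by rewrite gt0 ?mem_head.
have gt0v : {in v, forall y, 0 < y}%N by move=> z zv; rewrite gt0 // inE zv orbT.
have y0 : (y != 0%N) = true by rewrite -lt0n.
have L0 := run_length_gt0 y v.
rewrite /= gt0y y0 /= (consec_decr_cons x) //=; case: ifP => ltyx.
  by have [N -> EN] := IHv y r.+1 gt0v; exists N => //; move: EN; lia.
have [N -> EN] := IHv y 0%N gt0v; exists ((r.+2 - s) + N)%N.
  by rewrite phiE exprD.
by move: EN; lia.
Qed.

(** * Sorting words by a decreasing prefix *)
Definition perm_sum (R : comNzRingType) (phi : nat -> R) (s : seq nat) : R :=
  \sum_(w <- permutations s) run_weight phi w.

Definition one_repeated (k j : nat) : seq nat := nseq k 1%N ++ iota 2 j.

Lemma perm_sum_map (R : comNzRingType) (phi : nat -> R) (h : nat -> nat) s :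
  {in s, forall x, (0 < h x)%N = (0 < x)%N} ->
  {in s &, forall x y, (h x < h y)%N = (x < y)%N} ->
  perm_sum phi (map h s) = perm_sum phi s.
Proof.
move=> h0 hlt; have inj_h : {in s &, injective h}.
  by move=> x y xs ys Eh; have := hlt _ _ xs ys; have := hlt _ _ ys xs; rewrite Eh ltnn; lia.
rewrite /perm_sum sum_permutations_map //.
apply: eq_big_seq => w; rewrite mem_permutations => pw.
rewrite run_weight_map // => [x|x y]; rewrite !(perm_mem pw).
  exact: h0.
exact: hlt.
Qed.

(** Only the relative order of the letters matters. *)
Lemma perm_sum_one_repeated (R : comNzRingType) (phi : nat -> R) k t :
  sorted ltn t -> {in t, forall x, 1 < x}%N ->
  perm_sum phi (nseq k 1%N ++ t) = perm_sum phi (one_repeated k (size t)).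
Proof.
move=> sorted_t gt1; pose h x := if (x <= 1)%N then x else nth 0%N t (x - 2).
have Et : map h (one_repeated k (size t)) = nseq k 1%N ++ t.
  rewrite /one_repeated map_cat map_nseq; congr (_ ++ _).
  rewrite -[2%N]addn0 iotaDl -map_comp -[RHS](mkseq_nth 0%N); apply: eq_map => i /=.
  by rewrite /h add2n subSS subn1.
rewrite -Et perm_sum_map // => [x|x y]; rewrite !mem_cat !mem_nseq !mem_iota.
  case/orP=> [/andP [_ /eqP ->] //|/andP [le2x ltx]]; rewrite /h (leqNgt x 1) le2x /=.
  rewrite (ltnW le2x); apply: ltnW; apply: gt1.
  by rewrite mem_nth // ltn_subLR.
have h1 : h 1%N = 1%N by [].
have gt1h z : (2 <= z < 2 + size t)%N -> (1 < h z)%N.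
  by move=> /andP [le2z ltz]; rewrite /h (leqNgt z 1) le2z /= gt1 // mem_nth // ltn_subLR.
move=> /orP [/andP [_ /eqP ->]|hx] /orP [/andP [_ /eqP ->]|hy].
- by rewrite !ltnn.
- by rewrite h1 gt1h //; case/andP: hy => ->.
- rewrite h1; apply/idP/idP => [lthx|ltx1].
    by have := ltn_trans lthx (gt1h _ hx); rewrite ltnn.
  by case/andP: hx => /(ltn_trans ltx1); rewrite ltnn.
case/andP: hx hy => [gt1x ltx] /andP [gt1y lty].
rewrite -ltn_subLR // in ltx; rewrite -ltn_subLR // in lty.
rewrite /h [(x <= 1)%N]leqNgt gt1x [(y <= 1)%N]leqNgt gt1y /=.
have mono a b : (a < size t)%N -> (b < size t)%N -> (a < b)%N ->
    (nth 0 t a < nth 0 t b)%N.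
  move=> lta ltb; exact: (sorted_ltn_nth ltn_trans 0%N sorted_t).
have [ltxy|ltyx|->] := ltngtP x y; rewrite ?ltnn //.
  by apply: mono => //; lia.
apply/negbTE; rewrite -leqNgt ltnW //; by apply: mono => //; lia.
Qed.

(** A subset [D] of the letters 1, ..., j + 1 is encoded in ['I_j.+1] by
    predecessors; [ord0] stands for the letter 1. *)
Definition letter_in (j : nat) (D : {set 'I_j.+1}) (x : nat) : bool := inord x.-1 \in D.

Definition decr_word (j : nat) (D : {set 'I_j.+1}) : seq nat :=
  rev [seq x <- iota 1 j.+1 | letter_in D x].

Definition rest (k j : nat) (D : {set 'I_j.+1}) : seq nat :=
  nseq (k - (ord0 \in D)) 1%N ++ [seq x <- iota 2 j | ~~ letter_in D x].

(** The sets of [m] letters available in [one_repeated k j]: 1 is missing when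
    [k = 0]. *)
Definition drawable (k m j : nat) (D : {set 'I_j.+1}) : bool :=
  (#|D| == m) && ((0 < k)%N || (ord0 \notin D)).

Lemma letter_in1 (j : nat) (D : {set 'I_j.+1}) : letter_in D 1 = (ord0 \in D).
Proof. by rewrite /letter_in; congr (_ \in D); apply/val_inj; rewrite /= inordK. Qed.

Lemma count_letter_in (j : nat) (D : {set 'I_j.+1}) :
  count (letter_in D) (iota 1 j.+1) = #|D|.
Proof.
rewrite -[1%N]addn0 iotaDl count_map -sum1_count -[iota 0 _]/(index_iota 0 j.+1).
rewrite big_mkord -sum1_card; apply: eq_bigl => i /=.
by rewrite /letter_in /= inord_val.
Qed.

Lemma size_decr_word (j : nat) (D : {set 'I_j.+1}) : size (decr_word D) = #|D|.
Proof. by rewrite size_rev size_filter count_letter_in. Qed.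

Lemma sorted_decr_word (j : nat) (D : {set 'I_j.+1}) : sorted gtn (decr_word D).
Proof.
rewrite rev_sorted; apply: sorted_filter; first exact: ltn_trans.
exact: iota_ltn_sorted.
Qed.

Lemma decr_word_inj (j : nat) : injective (@decr_word j).
Proof.
move=> D D' E; apply/setP => i.
have i1 : i.+1 \in iota 1 j.+1 by rewrite mem_iota /= add1n ltnS.
have memE (A : {set 'I_j.+1}) : (i.+1 \in decr_word A) = (i \in A).
  by rewrite mem_rev mem_filter i1 andbT /letter_in inord_val.
by rewrite -!memE E.
Qed.

Lemma perm_decr_word_rest k m (j : nat) (D : {set 'I_j.+1}) :
  drawable k m D -> perm_eq (decr_word D ++ rest k D) (one_repeated k j).
Proof.
move=> /andP [_ hk]; rewrite /decr_word /rest /one_repeated.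
have E1 : iota 1 j.+1 = 1%N :: iota 2 j by [].
apply/permP => a; rewrite !count_cat count_rev E1 [filter _ (_ :: _)]/= letter_in1.
have -> : count a (iota 2 j) = (count a [seq x <- iota 2 j | letter_in D x] +
    count a [seq x <- iota 2 j | ~~ letter_in D x])%N.
  rewrite -count_cat; apply/esym.
  exact: (permP (permEl (perm_filterC (letter_in D) (iota 2 j)))).
rewrite !count_nseq; case: (ord0 \in D) hk => /=; last by rewrite subn0; lia.
by rewrite orbF; case: k => // k _; rewrite subSS subn0 mulnS; lia.
Qed.

(** A strictly decreasing prefix is determined by its set of letters. *)
Lemma sum_sorted_take (V : nmodType) (F : seq nat -> V) k m j :
  \sum_(w <- permutations (one_repeated k j) | sorted gtn (take m w) && (m <= size w)%N)
    F (drop m w) =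
  \sum_(D : {set 'I_j.+1} | drawable k m D) \sum_(v <- permutations (rest k D)) F v.
Proof.
pose r1 := [seq w <- permutations (one_repeated k j) |
  sorted gtn (take m w) && (m <= size w)%N].
pose Ds := enum (@drawable k m j).
transitivity (\sum_(D <- Ds) \sum_(v <- permutations (rest k D)) F v); last first.
  by rewrite big_enum.
rewrite -big_filter -/r1.
pose r2 := [seq (D, v) | D <- Ds, v <- permutations (rest k D)].
rewrite -(big_allpairs_dep (h := fun (D : {set 'I_j.+1}) (v : seq nat) => (D, v))
            (F := fun Dv => F Dv.2)) -/r2.
have mem2 Dv : Dv \in r2 -> drawable k m Dv.1 /\ perm_eq Dv.2 (rest k Dv.1).
  case/allpairsPdep => D [v []]; rewrite mem_enum mem_permutations => dD pv ->.
  by [].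
have permD (D : {set 'I_j.+1}) v : drawable k m D -> perm_eq (decr_word D ++ v) (one_repeated k j) =
    perm_eq v (rest k D).
  by move=> dD; rewrite -(permPr (perm_decr_word_rest dD)) perm_cat2l.
have take_decr (D : {set 'I_j.+1}) v : drawable k m D -> take m (decr_word D ++ v) = decr_word D.
  by move=> /andP [/eqP cD _]; rewrite take_size_cat // size_decr_word.
have drop_decr (D : {set 'I_j.+1}) v : drawable k m D -> drop m (decr_word D ++ v) = v.
  by move=> /andP [/eqP cD _]; rewrite drop_size_cat // size_decr_word.
apply: (eq_sum_rel (rel := fun w Dv => w = decr_word Dv.1 ++ Dv.2)).
- exact: filter_uniq (permutations_uniq _).
- apply: allpairs_uniq_dep; rewrite ?enum_uniq //.
    by move=> D _; apply: permutations_uniq.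
  by move=> [D v] [D' v'] _ _ /= [-> ->].
- move=> w; rewrite mem_filter mem_permutations => /andP [/andP [sw lem] pw].
  pose D := [set i : 'I_j.+1 | i.+1 \in take m w].
  have ED : decr_word D = take m w.
    apply: (irr_sorted_eq (leT := gtn)) => //.
    + by move=> x y z /= ltxy ltzx; apply: ltn_trans ltzx ltxy.
    + by move=> x /=; rewrite ltnn.
    + exact: sorted_decr_word.
    move=> x; rewrite mem_rev mem_filter mem_iota /letter_in.
    have [xw|xNw] := boolP (x \in take m w).
      have : x \in one_repeated k j by rewrite -(perm_mem pw) (mem_take xw).
      rewrite mem_cat mem_nseq mem_iota => hx.
      have hx' : (1 <= x < 1 + j.+1)%N.
        by move: hx => /orP [/andP [_ /eqP ->]|]; lia.
      by rewrite hx' andbT inE inordK ?prednK //; move: hx'; lia.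
    apply/negP => /andP [+ hx]; rewrite inE inordK ?prednK ?(negPf xNw) //;
      by move: hx; lia.
  have cD : #|D| = m by rewrite -size_decr_word ED size_takel.
  have dD : drawable k m D.
    rewrite /drawable cD eqxx /=; case: posnP => // k0 /=.
    rewrite inE /=; apply/negP => /mem_take; rewrite (perm_mem pw) k0.
    by rewrite mem_cat mem_iota.
  exists (D, drop m w); last by rewrite /= ED cat_take_drop.
  apply/allpairsPdep; exists D, (drop m w); split=> //; first by rewrite mem_enum.
  by rewrite mem_permutations -permD // ED cat_take_drop.
- move=> [D v] /mem2 [/= dD pv]; exists (decr_word D ++ v) => //.
  rewrite mem_filter mem_permutations permD // pv take_decr // sorted_decr_word.
  by case/andP: dD => /eqP cD _; rewrite size_cat size_decr_word cD leq_addr.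
- move=> w [D v] [D' v'] _ /mem2 [/= dD _] /mem2 [/= dD' _] -> E.
  have ED : D = D'.
    by apply: decr_word_inj; rewrite -(take_decr D v) // E take_decr.
  by rewrite -ED in E *; rewrite -(drop_decr D v) // E drop_decr.
- by move=> w w' [D v] _ _ _ -> ->.
by move=> w [D v] _ /mem2 [/= dD _] ->; rewrite drop_decr.
Qed.

Lemma size_letters_out (j : nat) (D : {set 'I_j.+1}) :
  size [seq x <- iota 2 j | ~~ letter_in D x] = (j + (ord0 \in D) - #|D|)%N.
Proof.
have := count_predC (letter_in D) (iota 2 j); rewrite size_iota => Ej.
have := count_letter_in D; rewrite -[iota 1 j.+1]/(1%N :: iota 2 j) /= letter_in1.
have -> : size [seq x <- iota 2 j | ~~ letter_in D x] =
    count (predC (letter_in D)) (iota 2 j) by rewrite size_filter.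
by lia.
Qed.

Lemma perm_sum_rest (R : comNzRingType) (phi : nat -> R) k m j (D : {set 'I_j.+1}) :
  drawable k m D ->
  perm_sum phi (rest k D) =
  perm_sum phi (if ord0 \in D then one_repeated k.-1 (j - m.-1)
                else one_repeated k (j - m)).
Proof.
move=> /andP [/eqP cD _]; rewrite /rest perm_sum_one_repeated.
- rewrite size_letters_out cD; case: ifP => [D0|_]; last by rewrite subn0 addn0.
  have m0 : (0 < m)%N by rewrite -cD; apply/card_gt0P; exists ord0.
  by rewrite subn1; congr (perm_sum _ (one_repeated _ _)); move: m0; lia.
- by apply: sorted_filter; [exact: ltn_trans | exact: iota_ltn_sorted].
by move=> x; rewrite mem_filter mem_iota => /andP [_ /andP []].
Qed.

Lemma card_drawable_out (m j : nat) :
  #|[set D : {set 'I_j.+1} | (#|D| == m) && (ord0 \notin D)]| = 'C(j, m).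
Proof.
rewrite -[in RHS](_ : #|[set~ (ord0 : 'I_j.+1)]| = j); last by rewrite cardsC1 card_ord.
rewrite -cards_draws; apply: eq_card => D; rewrite !inE andbC; congr (_ && _).
by rewrite subsetC sub1set inE.
Qed.

(** Counting the complementary case and Pascal's rule. *)
Lemma card_drawable_in (m j : nat) : (0 < m)%N ->
  #|[set D : {set 'I_j.+1} | (#|D| == m) && (ord0 \in D)]| = 'C(j, m.-1).
Proof.
move=> m0; have := card_draws 'I_j.+1 m; rewrite card_ord.
rewrite -(cardsID [set D : {set 'I_j.+1} | ord0 \in D]).
case: m m0 => // m _; rewrite binS /=.
set A := _ :&: _; set B := _ :\: _ => cardAB.
have cB : #|B| = 'C(j, m.+1).
  by rewrite -card_drawable_out; apply: eq_card => D; rewrite !inE andbC.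
rewrite -(_ : #|A| = 'C(j, m)); last by move: cardAB; rewrite cB addnC => /addnI.
by apply: eq_card => D; rewrite !inE.
Qed.

(** The summands with [m > j + 1] vanish, as no decreasing prefix is longer than
    the number of distinct letters; this makes the range of [m] independent of
    [k]. *)
Lemma perm_sum_rec (R : comNzRingType) (phi W : nat -> R) k j :
  phi 0%N = 1 ->
  (forall r, (0 < r)%N -> phi r = \sum_(1 <= m < r.+1) W m * phi (r - m)%N) ->
  (0 < k + j)%N ->
  perm_sum phi (one_repeated k j) =
  \sum_(1 <= m < j.+2)
    W m * ('C(j, m)%:R * perm_sum phi (one_repeated k (j - m)) +
           'C(j, m.-1)%:R *
             (if k is k'.+1 then perm_sum phi (one_repeated k' (j - m.-1)) else 0)).
Proof.
move=> phi0 phiW kj0;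
pose t m : R := \sum_(w <- permutations (one_repeated k j)
  | sorted gtn (take m w) && (m <= size w)%N) run_weight phi (drop m w).
have size_w w : w \in permutations (one_repeated k j) -> size w = (k + j)%N.
  by rewrite mem_permutations => /perm_size ->; rewrite size_cat size_nseq size_iota.
(* The bound N is large enough for every prefix length and for m = j + 1. *)
pose N := (k + j + 2)%N.
have tE m : (0 < m)%N -> t m = 'C(j, m)%:R * perm_sum phi (one_repeated k (j - m)) +
           'C(j, m.-1)%:R *
             (if k is k'.+1 then perm_sum phi (one_repeated k' (j - m.-1)) else 0).
  move=> m0; rewrite /t sum_sorted_take.
  rewrite (bigID (fun D : {set 'I_j.+1} => ord0 \in D)) /= addrC; congr (_ + _).
    transitivity (\sum_(D in [set D : {set 'I_j.+1} | (#|D| == m) && (ord0 \notin D)])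
        perm_sum phi (one_repeated k (j - m))).
      apply: eq_big => [D|D /andP [dD /negPf D0]].
        by rewrite inE /drawable; case: (ord0 \in D); rewrite ?andbF ?orbT ?andbT.
      by have := perm_sum_rest phi dD; rewrite D0.
    by rewrite sumr_const card_drawable_out mulr_natl.
  case: k kj0 @t @N size_w => [|k] kj0 t N size_w.
    rewrite mulr0 big_pred0 // => D; rewrite /drawable.
    by case: (ord0 \in D); rewrite ?andbF.
  transitivity (\sum_(D in [set D : {set 'I_j.+1} | (#|D| == m) && (ord0 \in D)])
      perm_sum phi (one_repeated k (j - m.-1))).
    apply: eq_big => [D|D /andP [dD D0]]; first by rewrite inE /drawable andbT.
    by have := perm_sum_rest phi dD; rewrite D0.
  by rewrite sumr_const card_drawable_in // mulr_natl.
have -> : perm_sum phi (one_repeated k j) = \sum_(1 <= m < N) W m * t m.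
  under [RHS]eq_bigr do rewrite mulr_sumr.
  rewrite [RHS](exchange_big_dep xpredT) //= /perm_sum; apply: eq_big_seq => w pw.
  rewrite (run_weight_rec phi0 phiW); last first.
  - move=> x; move: pw; rewrite mem_permutations => /perm_mem ->.
    rewrite mem_cat mem_nseq mem_iota => /orP [/andP [_ /eqP ->] //|/andP [lt2x _]].
    exact: ltnW.
  - by rewrite -size_eq0 size_w // -lt0n.
  rewrite [LHS](big_nat_widen _ _ N); last by rewrite (size_w w pw) /N; lia.
  by apply: eq_bigl => m; rewrite ltnS.
have zero m : (j.+2 <= m)%N -> t m = 0.
  move=> ltjm; rewrite tE; last by apply: leq_trans ltjm.
  by rewrite !bin_small ?mul0r ?addr0 //; lia.
rewrite (@big_cat_nat _ _ _ j.+2) //=; last by rewrite /N; lia.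
rewrite [X in _ + X]big_nat_cond [X in _ + X]big1 ?addr0 => [|m /andP [/andP [lem _] _]].
  rewrite big_nat_cond [RHS]big_nat_cond; apply: eq_bigr => m /andP [/andP [m0 _] _].
  by rewrite tE.
by rewrite zero // mulr0.
Qed.

(** * The polynomials of the theorem as run weight sums *)
Lemma iota2S n : iota 2 n = map S (iota 1 n).
Proof. exact: (iotaDl 1 1 n). Qed.

Lemma multiset_word_mword n k : multiset_word n k = mword [seq k l | l <- iota 1 n].
Proof.
elim: n k => //= n IHn k; rewrite /multiset_word /=; congr (_ ++ _).
rewrite iota2S -!map_comp -(IHn (k \o S)) /multiset_word map_flatten -map_comp.
by congr flatten; apply: eq_map => l /=; rewrite map_nseq.
Qed.

Lemma mword_one_repeated k j : mword (k :: nseq j 1%N) = one_repeated k j.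
Proof.
rewrite /one_repeated /= iota2S; congr (_ ++ map S _).
by elim: j => //= j ->; rewrite iota2S.
Qed.

Lemma quasi_stirling_one_repeated k j w :
  perm_eq w (one_repeated k j) -> quasi_stirling w.
Proof.
move=> pw; apply/quasi_stirlingP => x y neq_xy; apply/negP => sxy.
have count1 z : z != 1%N -> (count_mem z w <= 1)%N.
  move=> z1; rewrite (permP pw) count_cat count_nseq /= eq_sym (negPf z1) mul0n.
  by rewrite count_uniq_mem ?iota_uniq //; case: (_ \in _).
have cx : (2 <= count_mem x w)%N.
  by have := leq_count_subseq (pred1 x) sxy; rewrite /= eqxx; lia.
have cy : (2 <= count_mem y w)%N.
  by have := leq_count_subseq (pred1 y) sxy; rewrite /= eqxx; lia.
have [x1|/count1] := eqVneq x 1%N; last by rewrite leqNgt cx.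
by have /count1 : y != 1%N; [rewrite -x1 eq_sym|rewrite leqNgt cy].
Qed.

Lemma quasi_sum_one_repeated (R : comNzRingType) (phi : nat -> R) k j :
  quasi_sum phi (one_repeated k j) = perm_sum phi (one_repeated k j).
Proof.
rewrite /quasi_sum /perm_sum big_mkcond; apply: eq_big_seq => w.
by rewrite mem_permutations => /quasi_stirling_one_repeated ->.
Qed.

Lemma one_repeated_gt0 k j : {in one_repeated k j, forall x, 0 < x}%N.
Proof.
by move=> x; rewrite mem_cat mem_nseq mem_iota => /orP [/andP [_ /eqP ->]|]; lia.
Qed.

Lemma p_quasi_mword s n k : (0 < s)%N ->
  p_quasi s n k = quasi_sum (run_series s) (mword [seq k l | l <- iota 1 n]).
Proof.
move=> s0; rewrite /p_quasi multiset_word_mword /quasi_sum.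
rewrite big_seq_cond [RHS]big_seq_cond; apply: eq_bigr => w.
rewrite mem_permutations => /andP [pw _]; rewrite run_weight_consec // => x.
by rewrite (perm_mem pw); apply: mword_gt0.
Qed.

Lemma p_perm_sum s j k : (0 < s)%N ->
  p_ s (Posz j.+1) (Posz k) = perm_sum (run_series s) (one_repeated k j).
Proof.
move=> s0; rewrite /p_ /=.
have -> : multiset_word j.+1 (fun l => if l == 1%N then k else 1%N) = one_repeated k j.
  rewrite /multiset_word /one_repeated /=; congr (_ ++ _).
  have : all (fun l => l != 1%N) (iota 2 j).
    by apply/allP => l; rewrite mem_iota; case: l => [|[]].
  by elim: (iota 2 j) => //= l t IHt /andP [/negPf -> /IHt ->].
apply: eq_big_seq => w; rewrite mem_permutations => pw; rewrite run_weight_consec //.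
by move=> x; rewrite (perm_mem pw); apply: one_repeated_gt0.
Qed.

Lemma p_eq0 s n k : (n <= 0) || (k < 0) -> p_ s n k = 0.
Proof. by rewrite /p_ => ->. Qed.

Lemma run_series_unit s : (0 < s)%N -> run_series s \is a GRing.unit.
Proof. by move=> s0; rewrite qualifE /= /fps_unit /= s0 unitr1. Qed.

Lemma run_series0 s : (0 < s)%N -> run_series s 0%N = 1.
Proof. by move=> s0; rewrite /= s0. Qed.

Lemma Wt0 s : (0 < s)%N -> Wt s 0 = 0.
Proof.
move=> s0; have /fpsP /(_ 0%N) := mulrV (run_series_unit s0).
rewrite [LHS]/= big_ord1 /= s0 mul1r subn0 => E.
by rewrite /Wt /= E subrr.
Qed.

Lemma run_series_rec s r : (0 < s)%N -> (0 < r)%N ->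
  run_series s r = \sum_(1 <= m < r.+1) Wt s m * run_series s (r - m)%N.
Proof.
move=> s0 r0; pose V := 1 - (run_series s)^-1.
have EV : run_series s = 1 + V * run_series s.
  by rewrite /V mulrBl mul1r mulVr ?run_series_unit // addrC subrK.
have EVr : run_series s r = \sum_(m < r.+1) Wt s m * run_series s (r - m)%N.
  by have /fpsP /(_ r) := EV => /= ->; case: (r) r0 => // r' _ /=; rewrite add0r.
rewrite {}EVr -(big_mkord xpredT (fun m => Wt s m * run_series s (r - m)%N)).
by rewrite big_ltn // Wt0 // mul0r add0r.
Qed.

Lemma p_quasi_p s n k : (0 < s)%N -> (0 < n)%N ->
  (forall l : nat, (1 <= l <= n)%N -> (0 < k l)%N) ->
  let K := (\sum_(1 <= l < n.+1) k l)%N in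
  p_quasi s n k = p_ s n%:Z (K%:Z - n%:Z + 1).
Proof.
move=> s0; case: n => // n _ k0 K.
have EK : sumn [seq k l | l <- iota 1 n.+1] = K.
  by rewrite /K sumnE big_map /index_iota subn1.
rewrite p_quasi_mword // (quasi_sum_uniform (n := n)) ?run_series0 ?size_map ?size_iota //; last first.
  by move=> _ /mapP [l + ->]; rewrite mem_iota => lin; apply: k0; lia.
rewrite EK mword_one_repeated quasi_sum_one_repeated.
have leK : (n < K)%N.
  have : (\sum_(1 <= l < n.+2) 1 <= K)%N.
    by rewrite /K !big_nat; apply: leq_sum => l lin; apply: k0; lia.
  by rewrite sum_nat_const_nat muln1; lia.
have -> : K%:Z - n.+1%:Z + 1 = Posz (K - n) by lia.
by rewrite p_perm_sum.
Qed.

(** * Recurrence and initial conditions *)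
Lemma p_rec s j k : (0 < s)%N -> (0 < k + j)%N ->
  p_ s j.+1%:Z k%:Z =
  \sum_(1 <= m < j.+2)
    Wt s m * ('C(j, m)%:R * p_ s (j.+1%:Z - m%:Z) k%:Z +
              'C(j, m.-1)%:R * p_ s (j.+1%:Z - m%:Z + 1) (k%:Z - 1)).
Proof.
move=> s0 kj0; rewrite p_perm_sum // (perm_sum_rec (run_series0 s0) (fun r => run_series_rec s0)) //.
rewrite big_nat_cond [RHS]big_nat_cond; apply: eq_bigr => m /andP [/andP [m1 lem] _].
congr (_ * (_ + _ * _)).
  have [lemj|ltjm] := leqP m j; last by rewrite bin_small // !mul0r.
  by rewrite (_ : j.+1%:Z - m%:Z = (j - m).+1%:Z) ?p_perm_sum //; lia.
case: k {kj0} => [|k]; first by rewrite p_eq0 // orbT.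
rewrite (_ : j.+1%:Z - m%:Z + 1 = (j - m.-1).+1%:Z); last by lia.
by rewrite (_ : k.+1%:Z - 1 = k%:Z) ?p_perm_sum //; lia.
Qed.

Lemma p_no_one s n : (0 < s)%N -> (2 <= n)%N -> p_ s n%:Z 0 = p_ s (n%:Z - 1) 1.
Proof.
case: n => [|[|n]] // s0 _.
rewrite (p_perm_sum n.+1 0) // (_ : n.+2%:Z - 1 = n.+1%:Z); last by lia.
rewrite (p_perm_sum n 1) // /one_repeated /= -[2%N :: iota 3 n]/(iota 2 n.+1) iota2S.
by rewrite perm_sum_map // => x; rewrite mem_iota => /andP [].
Qed.

(** Below [s] the run series is 1 + z + z^2 + ..., with inverse 1 - z. *)
Lemma Wt_small s m : (0 < s)%N -> (0 < m < s)%N -> Wt s m = (m == 1%N)%:R.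
Proof.
move=> s0 /andP [m0 lts].
have S1 r : (0 < r < s)%N -> \sum_(1 <= i < r.+1) Wt s i = 1.
  move=> /andP [r0 ltrs]; have := run_series_rec s0 r0.
  rewrite [LHS]/= ltrs => ->; rewrite big_nat_cond [RHS]big_nat_cond.
  apply: eq_bigr => i /andP [/andP [_ ler] _].
  by rewrite /= (leq_ltn_trans (leq_subr _ _) ltrs) mulr1.
have := S1 m; rewrite m0 lts big_nat_recr //= => /(_ isT).
case: m m0 lts => // -[|m] _ lts; first by rewrite big_geq // add0r.
by rewrite (S1 m.+1) ?(ltnW lts) //= -[RHS]addr0 => /addrI.
Qed.

Lemma p_rec_small s j k : (0 < s)%N -> (j.+1 < s)%N -> (0 < k + j)%N ->
  p_ s j.+1%:Z k%:Z = j%:R * p_ s j%:Z k%:Z + p_ s j.+1%:Z (k%:Z - 1).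
Proof.
move=> s0 ltjs kj0; rewrite p_rec // big_ltn // Wt_small //=; last by lia.
rewrite big_nat_cond big1 => [|m /andP [/andP [m1 lem] _]]; last first.
  rewrite Wt_small //; last by lia.
  by rewrite (_ : (m == 1%N) = false) ?mul0r //; lia.
rewrite mul1r addr0 bin1 bin0 mul1r (_ : j.+1%:Z - 1%:Z = j%:Z); last by lia.
by rewrite (_ : j%:Z + 1 = j.+1%:Z) //; lia.
Qed.

Lemma p_initial s n k : (0 < s)%N -> (1 <= n <= s - 1)%N ->
  p_ s n%:Z k%:Z = ((n + k - 1)`!%:R / k`!%:R)%:P.
Proof.
move=> s0; case: n => // j /andP [_ lejs]; rewrite addSn subn1 /=.
have {lejs} : (j.+1 < s)%N by lia.
have fact_neq0 i : i`!%:R != 0 :> rat by rewrite pnatr_eq0 -lt0n fact_gt0.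
have natP i : (i%:R : {poly rat}) = i%:R%:P by rewrite polyCMn.
elim: j k => [|j IHj]; elim=> [|k IHk] ltjs.
- by rewrite p_perm_sum // /perm_sum big_seq1 run_weight_nil run_series0 // divr1.
- rewrite p_rec_small // mul0r add0r (_ : k.+1%:Z - 1 = k%:Z); last by lia.
  by rewrite IHk // !add0n !divff.
- rewrite p_rec_small // [p_ s _ (0 - 1)]p_eq0 ?orbT // addr0 IHj; last exact: ltnW.
  by rewrite !addn0 !divr1 natP -polyCM -natrM -factS.
rewrite p_rec_small // (_ : k.+1%:Z - 1 = k%:Z); last by lia.
rewrite IHk // IHj; last exact: ltnW.
rewrite natP -polyCM -polyCD; congr _%:P.
rewrite addnS -addSn (addnS j.+1 k) (factS k) (factS (j.+1 + k)%N) !natrM.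
have := fact_neq0 k; have : k.+1%:R != 0 :> rat by rewrite pnatr_eq0.
set F : rat := (j.+1 + k)`!%:R; set f : rat := k`!%:R => k0 f0.
have -> : (j.+1 + k).+1%:R = j.+1%:R + k.+1%:R :> rat by rewrite -natrD addnS.
by field; rewrite f0 nat1r.
Qed.

(** * The exponential generating function *)
Lemma coef_fps_mulC (R : comNzRingType) (f : {fps R}) (c : R) n :
  (f * c%:S) n = f n * c.
Proof.
rewrite mulrC /= big_ord_recl /= subn0 big1 ?addr0 1?mulrC // => i _.
by rewrite mul0r.
Qed.

Lemma coef_fps_mulX (R : comNzRingType) (f : {fps R}) n :
  (fpsX R * f) n = if n is n'.+1 then f n' else 0.
Proof.
case: n => [|n]; first by rewrite /= big_ord1 /= mul0r.
rewrite /= big_ord_recl /= mul0r add0r big_ord_recl /= mul1r subSS subn0.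
by rewrite big1 ?addr0 // => i _; rewrite mul0r.
Qed.

Lemma P_egf_coefS s j k :
  P_egf s k j.+1 = (j`!%:R^-1 : rat) *: p_ s j.+1%:Z k%:Z.
Proof. by []. Qed.

Lemma invf_bin (j m : nat) : (m <= j)%N ->
  (j`!%:R^-1 * 'C(j, m)%:R : rat) = m`!%:R^-1 * (j - m)`!%:R^-1.
Proof.
move=> lemj; rewrite -(bin_fact lemj) !natrM.
have fact_neq0 i : i`!%:R != 0 :> rat by rewrite pnatr_eq0 -lt0n fact_gt0.
have bin0 : 'C(j, m)%:R != 0 :> rat by rewrite pnatr_eq0 -lt0n bin_gt0.
by field; rewrite bin0 !fact_neq0.
Qed.

Lemma scale_bin_mul (j m : nat) (W p : {poly rat}) : (m <= j)%N ->
  (j`!%:R^-1 : rat) *: (W * ('C(j, m)%:R * p)) =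
  ((m`!%:R^-1 : rat) *: W) * (((j - m)`!%:R^-1 : rat) *: p).
Proof.
move=> lemj; rewrite mulr_natl -scaler_nat -!scalerAr -scalerAl !scalerA.
by rewrite invf_bin // mulrC.
Qed.

(** The recurrence divided by [j`!]: the binomial coefficients are absorbed by
    the factorials of the exponential series.  The coefficient of x^j in the
    derivative of [Wt_egf s] is W_(j+1) / j!, which matches C(j, m - 1). *)
Lemma P_egf_rec s j k : (0 < s)%N -> (0 < k + j)%N ->
  P_egf s k j.+1 = (Wt_egf s * P_egf s k) j.+1 +
    (if k is k'.+1 then (fps_deriv (Wt_egf s) * P_egf s k') j.+1 else 0).
Proof.
move=> s0 kj0; rewrite P_egf_coefS p_rec // scaler_sumr.
under eq_bigr do rewrite mulrDr scalerDr.
rewrite big_split /=; congr (_ + _).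
  rewrite -(big_mkord xpredT (fun i => Wt_egf s i * P_egf s k (j.+1 - i)%N)).
  rewrite [RHS]big_ltn // mul0r add0r big_nat_cond [RHS]big_nat_cond.
  apply: eq_bigr => m /andP [/andP [m1 lem] _].
  have [ltjm|lemj] := ltnP j m.
    rewrite bin_small // mul0r mulr0 scaler0.
    by rewrite (_ : (j.+1 - m = 0)%N) ?mulr0 //; lia.
  rewrite subSn // P_egf_coefS /= (gtn_eqF m1) scale_bin_mul //.
  by rewrite (_ : j.+1%:Z - m%:Z = (j - m).+1%:Z) //; lia.
case: k {kj0} => [|k].
  by rewrite big1 // => m _; rewrite p_eq0 ?orbT // !mulr0 scaler0.
rewrite /= big_ord_recr /= subnn mulr0 addr0 big_add1 /= big_mkord.
apply: eq_bigr => i _; have leij : (i <= j)%N by rewrite -ltnS.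
rewrite scale_bin_mul // subSn //=.
rewrite (_ : j.+1%:Z - i.+1%:Z + 1 = (j - i).+1%:Z); last by lia.
rewrite (_ : k.+1%:Z - 1 = k%:Z); last by lia.
congr (_ * _); rewrite -scaler_nat scalerA; congr (_ *: _).
have fact_neq0 : i`!%:R != 0 :> rat by rewrite pnatr_eq0 -lt0n fact_gt0.
by rewrite factS natrM invfM mulrA divff ?mul1r // pnatr_eq0.
Qed.

Lemma P_egfE s : (0 < s)%N ->
  P_egf s = xvar / (1 - (Wt_egf s)%:S - yvar * (fps_deriv (Wt_egf s))%:S).
Proof.
move=> s0; set D := 1 - _ - _.
have D_unit : D \is a GRing.unit.
  have D00 : D 0%N 0%N = 1.
    have -> : D 0%N = 1 - Wt_egf s - (yvar * (fps_deriv (Wt_egf s))%:S) 0%N by [].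
    by rewrite coef_fps_mulX subr0 /= subr0.
  by rewrite qualifE /= /fps_unit qualifE /= /fps_unit D00 unitr1.
suff PD : P_egf s * D = xvar by rewrite -PD mulrK.
apply/fpsP => k; apply/fpsP => n.
have -> : P_egf s * D = P_egf s - P_egf s * (Wt_egf s)%:S -
    yvar * (P_egf s * (fps_deriv (Wt_egf s))%:S).
  by rewrite /D; ring.
have -> : (P_egf s - P_egf s * (Wt_egf s)%:S -
    yvar * (P_egf s * (fps_deriv (Wt_egf s))%:S)) k =
    P_egf s k - (P_egf s * (Wt_egf s)%:S) k -
    (yvar * (P_egf s * (fps_deriv (Wt_egf s))%:S)) k by [].
rewrite coef_fps_mulC coef_fps_mulX.
have -> : (match k with k'.+1 => (P_egf s * (fps_deriv (Wt_egf s))%:S) k' | 0%N => 0 end)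
   = (match k with k'.+1 => fps_deriv (Wt_egf s) * P_egf s k' | 0%N => 0 end).
  by case: (k) => // k'; rewrite coef_fps_mulC mulrC.
rewrite [P_egf s k * _]mulrC.
have -> : (P_egf s k - Wt_egf s * P_egf s k -
     match k with k'.+1 => fps_deriv (Wt_egf s) * P_egf s k' | 0%N => 0 end) n =
    P_egf s k n - (Wt_egf s * P_egf s k) n -
    (match k with k'.+1 => (fps_deriv (Wt_egf s) * P_egf s k') n | 0%N => 0 end).
  by case: (k).
case: n => [|j].
  have -> : xvar k 0%N = 0 by case: (k).
  rewrite [P_egf s k 0%N]/= [(Wt_egf s * _) 0%N]/= big_ord1 mul0r subr0 sub0r.
  by case: (k) => [|k']; rewrite ?oppr0 //= big_ord1 mulr0 oppr0.
have [kj0|kj0] := posnP (k + j); last first.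
  have -> : xvar k j.+1 = 0 by case: k j kj0 => [|k] [|j].
  by rewrite (P_egf_rec s0 kj0) (addrC (_ j.+1)) addrK subrr.
have [-> ->] : k = 0%N /\ j = 0%N by lia.
have -> : xvar 0%N 1%N = 1 by [].
rewrite P_egf_coefS p_perm_sum // /perm_sum big_seq1 run_weight_nil run_series0 //.
by rewrite /= big_ord_recl big_ord1 /= mul0r mulr0 addr0 !subr0 invr1 scale1r.
Qed.

Theorem theorem4p7 (s : nat) (hs : (0 < s)%N) :
  (forall (n : nat) (k : nat -> nat), (0 < n)%N ->
     (forall l : nat, (1 <= l <= n)%N -> (0 < k l)%N) ->
     let K := (\sum_(1 <= l < n.+1) k l)%N in
     p_quasi s n k = p_ s n%:Z (K%:Z - n%:Z + 1)) /\
  (forall n k : nat, (s <= n)%N -> (1 <= k)%N ->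
     p_ s n%:Z k%:Z =
     \sum_(1 <= m < n.+1)
       Wt s m * ('C(n - 1, m)%:R * p_ s (n%:Z - m%:Z) k%:Z +
                 'C(n - 1, m - 1)%:R *
                   p_ s (n%:Z - m%:Z + 1) (k%:Z - 1))) /\
  (forall n : nat, (2 <= n)%N -> p_ s n%:Z 0 = p_ s (n%:Z - 1) 1) /\
  (forall n k : nat, (1 <= n <= s - 1)%N ->
     p_ s n%:Z k%:Z = ((n + k - 1)`!%:R / k`!%:R)%:P) /\
  (forall n k : int, (n <= 0) || (k < 0) -> p_ s n k = 0) /\
  P_egf s =
    xvar / (1 - (Wt_egf s)%:S - yvar * (fps_deriv (Wt_egf s))%:S).
Proof.
split; first by move=> n k n0 k0; apply: p_quasi_p.
split.
  move=> [|j] k lesn k1; first by move: hs lesn; lia.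
  rewrite p_rec //; last by rewrite addn_gt0 k1.
  by rewrite subn1; apply: eq_bigr => m _; rewrite subn1.
split; first by move=> n; apply: p_no_one.
split; first by move=> n k; apply: p_initial.
split; first exact: p_eq0.
exact: P_egfE.
Qed.
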